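(* Let $L$ be an oriented link projection (link diagram in the plane). The graded Euler characteristic of the Khovanov complex $\mathcal{C}(L)$ is the unnormalized Jones polynomial of $L$: $$\chi_q(\mathcal{C}(L)) = \hat{J}(L).$$
   Context: Fix a ground field; all vector spaces are over it. **Link projections and smoothings.** Let $L$ be a planar projection of an oriented link, $\mathcal{X}$ its set of crossings, numbered $1,\dots,n$ in some order, $n=|\mathcal{X}|=n_++n_-$, with $n_+$ (resp. $n_-$) the number of right-handed (resp. left-handed) crossings. Each crossing has a 0-smoothing and a 1-smoothing. For a crossing drawn so that the over-strand runs from upper left to lower right, the 0-smoothing is the one consisting of an upper arc and a lower arc ($\asymp$), and the 1-smoothing is the one consisting of a left arc and a right arc ($)($). Equivalently, the 0-smoothing joins the two regions swept when the over-strand is rotated counterclockwise to the under-strand, and the 1-smoothing joins the other two regions. For $\alpha\in\{0,1\}^{\mathcal{X}}$, $S_\alpha$ is the complete smoothing of $L$ (a union of disjoint planar cycles) obtained by smoothing each crossing according to $\alpha$. The height of $\alpha$ is $|\alpha|=\sum_i\alpha_i$. **Kauffman bracket and Jones polynomial.** The Kauffman bracket $\langle L\rangle\in\mathbb{Z}[q,q^{-1}]$ is defined by $\langle\emptyset\rangle=1$, $\langle\bigcirc L\rangle=(q+q^{-1})\langle L\rangle$ (where $\bigcirc$ is a disjoint crossingless circle), and $\langle L\rangle=\langle L_0\rangle-q\langle L_1\rangle$, where $L_0,L_1$ are the 0- and 1-smoothings of $L$ at a given crossing. The unnormalized Jones polynomial is $\hat{J}(L)=(-1)^{n_-}q^{n_+-2n_-}\langle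 L\rangle$. **Gradings and shifts.** For a graded vector space $W=\bigoplus_m W_m$, the graded dimension is $q\dim W=\sum_m q^m\dim W_m$, and $W\{l\}$ is the graded space with $W\{l\}_m=W_{m-l}$. For a chain complex $\bar{\mathcal{C}}$ with pieces $\bar{\mathcal{C}}^r$ (of height $r$) and differentials $\bar{\mathcal C}^r\to\bar{\mathcal C}^{r+1}$, $\bar{\mathcal{C}}[s]$ is the complex with $(\bar{\mathcal{C}}[s])^r=\bar{\mathcal{C}}^{r-s}$, with differentials shifted accordingly. The graded Euler characteristic $\chi_q(\mathcal{C})$ of a complex of graded vector spaces is the alternating sum $\sum_r(-1)^r\,q\dim H^r(\mathcal{C})$ of the graded dimensions of its homology groups. **The complex $\mathcal{C}(L)$.** Let $V$ be the graded vector space with basis $v_+,v_-$ of degrees $+1,-1$. For $\alpha\in\{0,1\}^{\mathcal{X}}$ let $V_\alpha(L)=V^{\otimes k}\{|\alpha|\}$, where $k$ is the number of cycles of $S_\alpha$, the tensor factors being put in bijection with those cycles. Set $[[L]]^r=\bigoplus_{|\alpha|=r}V_\alpha(L)$ for $0\le r\le n$. Edges of the cube $\{0,1\}^{\mathcal{X}}$ are labeled by $\xi\in\{0,1,\star\}^{\mathcal{X}}$ with exactly one $\star$; the tail (resp. head) of $\xi$ is obtained by $\star\to0$ (resp. $\star\to1$), $|\xi|$ is the height of the tail, and $(-1)^\xi=(-1)^{\sum_{i<j}\xi_i}$, where $j$ is the position of $\star$. Passing from tail to head, either two cycles merge into one or one cycle splits into two. The map $d_\xi$ from the space at the tail to the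 space at the head is the identity on tensor factors of the cycles not involved, and on the involved factors is $m:V\otimes V\to V$ in the case of a merge and $\Delta:V\to V\otimes V$ in the case of a split, where $$m:\ v_+\otimes v_+\mapsto v_+,\quad v_+\otimes v_-\mapsto v_-,\quad v_-\otimes v_+\mapsto v_-,\quad v_-\otimes v_-\mapsto0,$$ $$\Delta:\ v_+\mapsto v_+\otimes v_-+v_-\otimes v_+,\quad v_-\mapsto v_-\otimes v_-.$$ The differential on $[[L]]$ is $d^r=\sum_{|\xi|=r}(-1)^\xi d_\xi:[[L]]^r\to[[L]]^{r+1}$. These maps have degree $0$ and make $[[L]]$ a chain complex. Finally $\mathcal{C}(L)=[[L]][-n_-]\{n_+-2n_-\}$, where here the height shift by $[-n_-]$ is taken so that $[[L]]^r$ is placed in height $r-n_-$. *)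

(* Defs.v *)
From HB Require Import structures.
From mathcomp Require Import all_boot all_order all_algebra.
From mathcomp Require Import ring classical_sets fsbigop.

Set Implicit Arguments.
Unset Strict Implicit.
Unset Printing Implicit Defensive.

Import GRing.Theory.
Local Open Scope ring_scope.

(** * Laurent polynomials *)

(* Z[q, q^-1] is computed in, inside its fraction field Q(q) = Frac Z[q]. *)
Definition laurent : Type := {fraction {poly int}}.
Definition q : laurent := tofrac ('X : {poly int}).

(** * Crossings and smoothings *)

(* A crossing lists the edges at its four ends in counterclockwise order,
   ends 0 and 2 being those of the under-strand.  Rotating the over-strand
   (1,3) counterclockwise to the under-strand sweeps the corners between ends
   1, 2 and between ends 3, 0; joining these two regions leaves the arcs 0-1
   and 2-3.  Exchanging the two under-ends (0 <-> 2, 1 <-> 3) changes nothing. *)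
Definition crossing (E : Type) : Type := 'Z_4 -> E.

Definition smoothing (E : Type) (x : crossing E) (b : bool) : seq (E * E) :=
  if b then [:: (x 1, x 2); (x 3, x 0)] else [:: (x 0, x 1); (x 2, x 3)].

Definition linked (E : eqType) (s : seq (E * E)) : rel E :=
  fun a b => ((a, b) \in s) || ((b, a) \in s).

(* The cycles obtained from the edges in E by attaching them along the arcs
   in s are the connected components of [linked s]. *)
Definition ncycles (E : finType) (s : seq (E * E)) : nat :=
  n_comp (linked s) predT.

(* Bracket of the projection with edges E and crossings xs, in which other
   crossings may already have been replaced by the arcs in s: the first
   crossing is resolved by <L> = <L_0> - q <L_1>.  A crossingless projection
   with k cycles has bracket (q + q^-1)^k, by <O L> = (q + q^-1) <L> and
   <empty> = 1. *)
Fixpoint bracket (E : finType) (xs : seq (crossing E)) (s : seq (E * E)) :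
    laurent :=
  if xs is x :: xs' then
    bracket xs' (smoothing x false ++ s) - q * bracket xs' (smoothing x true ++ s)
  else (q + q^-1) ^+ ncycles s.

(* The order in which the crossings are resolved is irrelevant. *)
Lemma bracket_skein (E : finType) (xs ys : seq (crossing E)) (x : crossing E)
    (s : seq (E * E)) :
  bracket (xs ++ x :: ys) s =
  bracket (xs ++ ys) (smoothing x false ++ s)
    - q * bracket (xs ++ ys) (smoothing x true ++ s).
Proof.
have bracket_mem zs (t u : seq (E * E)) :
    t =i u -> bracket zs t = bracket zs u.
  elim: zs t u => [|z zs IH] t u tu /=.
    congr (_ ^+ _); apply: eq_n_comp; apply: eq_connect => a b.
    by rewrite /linked !tu.
  by congr (_ - _ * _); apply: IH => p; rewrite !inE tu.
elim: xs s => [//|z xs IH] s.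
rewrite !cat_cons ![bracket (z :: _) _]/bracket -/bracket !IH.
have swap b c : bracket (xs ++ ys) (smoothing x b ++ (smoothing z c ++ s)) =
    bracket (xs ++ ys) (smoothing z c ++ (smoothing x b ++ s)).
  by apply: bracket_mem => p; rewrite !mem_cat orbCA.
rewrite !swap; ring.
Qed.

(** * Oriented link projections *)

(* Ends are numbered so that the under-strand goes from end 0 to end 2.  The
   over-strand then goes from end 3 to end 1 at a right-handed crossing, and
   from end 1 to end 3 at a left-handed one. *)
Definition end_in (right over : bool) : 'Z_4 :=
  if over then (if right then 3 else 1) else 0.
Definition end_out (right over : bool) : 'Z_4 :=
  if over then (if right then 1 else 3) else 2.

Section Planarity.
Variables (n : nat) (E : finType) (ends : 'I_n -> crossing E).

(* The pair (x, i) stands both for end i of the crossing x and for the corner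
   of x between ends i and i+1.  Walking out of x along end i+1 with corner
   (x, i) on the right, and arriving at the end (y, j) of the same edge, one
   has corner (y, j) on the right. *)
Definition corner_next : rel ('I_n * 'Z_4) := fun c c' =>
  let d := (c.1, c.2 + 1) in
  (c' != d) && (ends c'.1 c'.2 == ends d.1 d.2).

Definition nfaces : nat :=
  n_comp [rel c c' | corner_next c c' || corner_next c' c] predT.

Definition crossing_adj : rel 'I_n := fun x y =>
  [exists i, exists j, ends x i == ends y j].

(* Euler's formula V - E + F = 2C, summed over the C connected components of
   the 4-valent graph, which has n vertices and 2n edges; each component is
   drawn on its own sphere, and F counts the faces of all of them.  Edges that
   are at no crossing play no role here. *)
Definition planar : Prop := nfaces = (n + 2 * n_comp crossing_adj predT)%N.

End Planarity.

(* The edges at no crossing are the crossingless circle components of the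
   link.  All other edges run from an outgoing end to an incoming end.  How the
   connected components of the projection are nested in one another's faces is
   not recorded: the smoothings, as sets of cycles, do not depend on it. *)
Record link_projection := LinkProjection {
  ncr : nat;
  edge : finType;
  ends : 'I_ncr -> crossing edge;
  right_handed : 'I_ncr -> bool;
  edge_in := fun p : 'I_ncr * bool => ends p.1 (end_in (right_handed p.1) p.2);
  edge_out := fun p : 'I_ncr * bool => ends p.1 (end_out (right_handed p.1) p.2);
  edge_in_inj : injective edge_in;
  edge_out_inj : injective edge_out;
  edge_in_out : codom edge_in =i codom edge_out;
  ends_planar : planar ends
}.

Section Jones.
Variable L : link_projection.

Definition npos : nat := #|[set x : 'I_(ncr L) | right_handed x]|.
Definition nneg : nat := #|[set x : 'I_(ncr L) | ~~ right_handed x]|.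

Definition kauffman : laurent :=
  bracket [seq @ends L x | x <- enum 'I_(ncr L)] [::].

Definition jones : laurent :=
  (-1) ^+ nneg * q ^ (npos%:Z - 2 * nneg%:Z) * kauffman.

End Jones.

(** * Complexes of graded vector spaces *)

(* [gpiece C r m] is the subspace of degree m of [gobj C r].  The differential
   is [gdiff C r (r + 1)]; having it indexed by source and target avoids casts
   between [gobj C (r - 1 + 1)] and [gobj C r], and its value at other pairs is
   never used. *)
Record gcomplex (K : fieldType) := GComplex {
  gobj : int -> vectType K;
  gpiece : forall r : int, int -> {vspace gobj r};
  gdiff : forall r r' : int, 'Hom(gobj r, gobj r')
}.

Section Graded.
Variable K : fieldType.
Implicit Type C : gcomplex K.

Definition hshift C (s : int) : gcomplex K :=
  @GComplex K (fun r => gobj C (r - s)) (fun r m => gpiece C (r - s) m)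
    (fun r r' => gdiff C (r - s) (r' - s)).

Definition dshift C (l : int) : gcomplex K :=
  @GComplex K (gobj C) (fun r m => gpiece C r (m - l)) (gdiff C).

(* Degree m part of ker / (im :&: ker) at height r, which is ker / im when
   the differential squares to 0.  The quotient U / (U :&: V) is
   represented by the complement U :\: V of U :&: V in U. *)
Definition homology C (r m : int) : {vspace gobj C r} :=
  ((lker (gdiff C r (r + 1)) :&: gpiece C r m)
     :\: limg (gdiff C (r - 1) r))%VS.

(* Sums over all of int, with finitely many nonzero terms. *)
Definition qdim_homology C (r : int) : laurent :=
  \sum_(m \in [set: int]%classic) q ^ m * (\dim (homology C r m))%:R.

Definition euler_q C : laurent :=
  \sum_(r \in [set: int]%classic) (-1) ^ r * qdim_homology C r.

(* Structure constants of m and Delta on V; the booleans true and false stand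
   for v_+ and v_-. *)

(* coefficient of v_c in m (v_a (x) v_b) *)
Definition m_coef (a b c : bool) : K :=
  match a, b with
  | true, true => c%:R
  | true, false | false, true => (~~ c)%:R
  | false, false => 0
  end.

(* coefficient of v_b (x) v_c in Delta (v_a) *)
Definition Delta_coef (a b c : bool) : K :=
  if a then (b != c)%:R else (~~ b && ~~ c)%:R.

End Graded.

(** * The Khovanov complex *)

Section Khovanov.
Variables (K : fieldType) (L : link_projection).
Let n := ncr L.
Let E := edge L.

Definition vertex : Type := {ffun 'I_n -> bool}.

Definition height (al : vertex) : nat := \sum_i al i.

(* the cycles of S_al are the connected components of [on_cycle al] *)
Definition on_cycle (al : vertex) : rel E :=
  linked (flatten [seq smoothing (@ends L x) (al x) | x <- enum 'I_n]).

(* The basis of V_al made of tensor products of v_+ and v_- is indexed by the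
   maps from the set of cycles of S_al to {+, -}, that is, by the maps from E
   to {+, -} that are constant on each cycle. *)
Definition is_state (s : vertex * {ffun E -> bool}) : bool :=
  [forall a, forall b, connect (on_cycle s.1) a b ==> (s.2 a == s.2 b)].

(* [roots] selects one edge on each cycle; height s.1 is the shift {|al|}. *)
Definition state_deg (s : vertex * {ffun E -> bool}) : int :=
  \sum_(a | roots (on_cycle s.1) a) (if s.2 a then 1 else -1) + (height s.1)%:Z.

(* basis of [[L]]^r, the direct sum of the V_al with |al| = r *)
Definition state (r : int) : finType :=
  {s : vertex * {ffun E -> bool} | is_state s && ((height s.1)%:Z == r)}.

Definition chain (r : int) : vectType K := {ffun state r -> K^o}.

Definition basis_elt (r : int) (s : state r) : chain r :=
  [ffun t => (t == s)%:R].

Definition chain_piece (r m : int) : {vspace chain r} :=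
  <<[seq basis_elt s | s <- enum (state r) & state_deg (val s) == m]>>%VS.

(* An edge xi of the cube is given by its tail and the position of its star;
   it is required that the tail vanish at the star. *)
Definition cube_edge : Type := (vertex * 'I_n)%type.
Definition is_cube_edge (xi : cube_edge) : bool := ~~ xi.1 xi.2.
Definition cube_tail (xi : cube_edge) : vertex := xi.1.
Definition cube_head (xi : cube_edge) : vertex :=
  [ffun i => (i == xi.2) || xi.1 i].
Definition cube_sign (xi : cube_edge) : K :=
  (-1) ^+ (\sum_(i < n | (i < xi.2)%N) xi.1 i)%N.

(* Coefficient of d_xi from the basis element e at the tail to the basis
   element e' at the head.  At the crossing x of the star, the arcs 0-1 and 2-3
   are replaced by the arcs 1-2 and 3-0: two cycles merge if the former arcs lie
   on distinct cycles of the tail, and otherwise one cycle splits. *)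
Definition dxi_coef (xi : cube_edge) (e e' : {ffun E -> bool}) : K :=
  let x := @ends L xi.2 in
  let cyc := connect (on_cycle (cube_tail xi)) in
  if [forall a, [|| cyc (x 0) a, cyc (x 2) a | e' a == e a]] then
    if cyc (x 0) (x 2) then Delta_coef K (e (x 0)) (e' (x 1)) (e' (x 3))
    else m_coef K (e (x 0)) (e (x 2)) (e' (x 0))
  else 0.

(* d_xi, extended by 0 to the other summands of [[L]]^r *)
Definition dxi (xi : cube_edge) (r r' : int) : 'Hom(chain r, chain r') :=
  linfun (fun f : chain r => [ffun t : state r' =>
    \sum_(s : state r |
           ((val s).1 == cube_tail xi) && ((val t).1 == cube_head xi))
      (f s : K) * dxi_coef xi (val s).2 (val t).2] : chain r').

Definition chain_diff (r r' : int) : 'Hom(chain r, chain r') :=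
  \sum_(xi : cube_edge | is_cube_edge xi && ((height (cube_tail xi))%:Z == r))
    cube_sign xi *: dxi xi r r'.

Definition khovanov_bracket : gcomplex K :=
  @GComplex K chain chain_piece chain_diff.

Definition khovanov : gcomplex K :=
  dshift (hshift khovanov_bracket (- (nneg L)%:Z))
         ((npos L)%:Z - 2 * (nneg L)%:Z).

End Khovanov.

(* Main.v *)
From HB Require Import structures.
Require Import Defs.
From mathcomp Require Import all_boot all_order all_algebra.
From mathcomp Require Import perm ring zify classical_sets fsbigop.

Set Implicit Arguments.
Unset Strict Implicit.
Unset Printing Implicit Defensive.

Import Order.TTheory GRing.Theory Num.Theory.
Local Open Scope ring_scope.

(** Both sides are the same sum over states, where a state is a smoothing of all
    crossings together with a sign on each of its cycles.

    Resolving all crossings expands the Kauffman bracket into the sum of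
    (-q)^|al| (q + q^-1)^k over the smoothings al, k being the number of cycles
    ([kauffman_state_sum]); expanding the k-th power chooses a sign on each cycle
    ([state_sum]).  On the other side, states are the basis of the Khovanov
    complex, and the ranks of the differentials cancel in the alternating sum of
    the dimensions of the homology groups ([euler_q_pieces]).  For this last step
    the differential must have degree 0 and square 0, which is where the geometry
    of the projection enters.

    Degree 0 needs that every edge of the cube merges two cycles or splits one
    ([bifurcation]).  A planar projection can be oriented so that its edges lead
    alternately in and out around each crossing ([source_sink]); this follows
    from the vanishing of the cohomology of the sphere modulo 2, which is a count
    of ranks by Euler's formula.  Both smoothings of a crossing respect this
    orientation, so that the cycles of a smoothing are the cycles of a
    permutation of the edges, and changing one smoothing multiplies the
    permutation by a transposition.

    For square 0, the space at a vertex of the cube is the algebra generated by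
    variables X_a, one for each edge a of the projection, with X_a^2 = 0 and
    X_a = X_b if a and b lie on the same cycle ([monomial]).  A merge is then the
    quotient map, and a split is multiplication by the sum of the variables of
    the two new cycles ([edge_map_monomial]).  The two paths around a square of
    the cube thus multiply by products of such sums, which agree ([edge_imageC]);
    the signs make the paths cancel. *)

(** * Exactness of a pair of matrices by counting ranks *)

Section Rank.
Variable F : fieldType.

Definition fin_mx (X Y : finType) (g : X -> Y -> F) : 'M[F]_(#|X|, #|Y|) :=
  \matrix_(i, j) g (enum_val i) (enum_val j).

Lemma mulmx_fin_mx (X Y : finType) (g : X -> Y -> F) m (A : 'M_(m, #|X|)) i j :
  (A *m fin_mx g) i j =
  \sum_x A i (enum_rank x) * g x (enum_val j).
Proof.
rewrite mxE (reindex (@enum_rank X)) /=; last exact: onW_bij (enum_rank_bij X).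
by apply: eq_bigr => x _; rewrite mxE enum_rankK.
Qed.

(** Restriction to the points of [Z] is injective on the left kernel of [g],
    which therefore has dimension at most [#|Z|]. *)
Lemma leq_card_rank (X Y Z : finType) (g : X -> Y -> F) (z : Z -> X) :
  (forall w : X -> F, (forall y, \sum_x w x * g x y = 0) ->
     (forall k, w (z k) = 0) -> forall x, w x = 0) ->
  (#|X| <= \rank (fin_mx g) + #|Z|)%N.
Proof.
move=> w0; set G := fin_mx g.
pose R := fin_mx (fun x k => (x == z k)%:R).
have cap0 : (kermx G :&: kermx R)%MS = 0.
  apply/eqP/rowV0P => v; rewrite sub_capmx => /andP[/sub_kermxP vG /sub_kermxP vR].
  apply/rowP => i; rewrite mxE -(enum_valK i).
  apply: (w0 (fun x => v 0 (enum_rank x))) => [y|k].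
    have := congr1 (fun u : 'rV_#|Y| => u 0 (enum_rank y)) vG.
    by rewrite mulmx_fin_mx mxE enum_rankK.
  have := congr1 (fun u : 'rV_#|Z| => u 0 (enum_rank k)) vR.
  rewrite mulmx_fin_mx mxE enum_rankK (bigD1 (z k)) //= eqxx mulr1.
  by rewrite big1 ?addr0 // => x /negPf->; rewrite mulr0.
have := mxrank_mul_ker (kermx G) R.
rewrite cap0 mxrank0 addn0 mxrank_ker => eqr.
have := rank_leq_col (kermx G *m R); rewrite eqr leq_subLR.
by [].
Qed.

(** If two consecutive maps compose to 0 and their ranks add up to the dimension
    in the middle, then the image of the first is the kernel of the second. *)
Lemma exact_of_rank (X Y Z : finType) (g : X -> Y -> F) (h : Y -> Z -> F) :
  (forall x z, \sum_y g x y * h y z = 0) ->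
  (#|Y| <= \rank (fin_mx g) + \rank (fin_mx h))%N ->
  forall w : Y -> F, (forall z, \sum_y w y * h y z = 0) ->
  exists v : X -> F, forall y, w y = \sum_x v x * g x y.
Proof.
move=> gh0 rk w wh0.
have sub : (fin_mx g <= kermx (fin_mx h))%MS.
  apply/sub_kermxP/matrixP => i j; rewrite mulmx_fin_mx mxE.
  rewrite -[RHS](gh0 (enum_val i) (enum_val j)); apply: eq_bigr => y _.
  by rewrite mxE enum_rankK.
have eqk : (fin_mx g == kermx (fin_mx h))%MS.
  by rewrite -(geq_leqif (mxrank_leqif_eq sub)) mxrank_ker leq_subLR addnC.
pose W : 'rV_#|Y| := \row_j w (enum_val j).
have : (W <= fin_mx g)%MS.
  rewrite (eqmxP eqk); apply/sub_kermxP/rowP => j; rewrite mulmx_fin_mx mxE.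
  rewrite -[RHS](wh0 (enum_val j)); apply: eq_bigr => y _.
  by rewrite mxE enum_rankK.
case/submxP => v Wv; exists (fun x => v 0 (enum_rank x)) => y.
have := congr1 (fun u : 'rV_#|Y| => u 0 (enum_rank y)) Wv.
by rewrite mulmx_fin_mx mxE enum_rankK.
Qed.

End Rank.
(** * The source-sink orientation of a planar projection *)

Section Orientation.
Variable L : link_projection.
Let n := ncr L.
Let strand : finType := ('I_n * bool)%type.
Let dart : finType := ('I_n * 'Z_4)%type.

Definition dart_edge (d : dart) : edge L := @ends L d.1 d.2.
Definition dart_in (p : strand) : dart :=
  (p.1, end_in (@right_handed L p.1) p.2).
Definition dart_out (p : strand) : dart :=
  (p.1, end_out (@right_handed L p.1) p.2).

Lemma dart_in_edge_inj : injective (fun p => dart_edge (dart_in p)).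
Proof. exact: (@edge_in_inj L). Qed.

Lemma dart_out_edge_inj : injective (fun p => dart_edge (dart_out p)).
Proof. exact: (@edge_out_inj L). Qed.

Lemma dart_in_out p p' : dart_in p != dart_out p'.
Proof.
case: p p' => [x b] [y c]; apply/eqP => -[<-].
by case: (right_handed x) b c => [] [] [].
Qed.

Lemma big_darts (M : nmodType) (g : dart -> M) (x : 'I_n) :
  \sum_b (g (dart_in (x, b)) + g (dart_out (x, b))) = \sum_i g (x, i).
Proof.
rewrite big_bool /dart_in /dart_out /=.
have -> : \sum_i g (x, i) = g (x, 0) + g (x, 1) + g (x, 2) + g (x, 3).
  rewrite !big_ord_recl big_ord0 addr0 !addrA.
  by congr (_ + _ + _ + _); congr g; congr pair; apply: val_inj.
by case: (right_handed x) => /=;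
  [rewrite (AC (2*2) (3*2*4*1)) | rewrite (AC (2*2) (3*1*4*2))].
Qed.

Variant dart_spec (d : dart) : Type :=
  | DartIn p of d = dart_in p
  | DartOut p of d = dart_out p.

Lemma dartP d : dart_spec d.
Proof.
case: d => x i.
pose rh := right_handed x.
have [e|] := eqVneq i (end_in rh true).
  by apply: (@DartIn _ (x, true)); rewrite e.
have [e _|] := eqVneq i (end_in rh false).
  by apply: (@DartIn _ (x, false)); rewrite e.
have [e _ _|] := eqVneq i (end_out rh true).
  by apply: (@DartOut _ (x, true)); rewrite e.
have [e _ _ _|] := eqVneq i (end_out rh false).
  by apply: (@DartOut _ (x, false)); rewrite e.
by case: rh => /=; case: i => [[|[|[|[|//]]]] ?].
Qed.

Lemma edge_in_codom_out p :
  dart_edge (dart_in p) \in codom (fun p' => dart_edge (dart_out p')).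
Proof.
have := @edge_in_out L (edge_in p).
by rewrite codom_f => /esym.
Qed.

(** The strand that leaves its crossing along the edge by which [p] arrives. *)
Definition prev_strand (p : strand) : strand := iinv (edge_in_codom_out p).

Lemma prev_strandP p :
  dart_edge (dart_out (prev_strand p)) = dart_edge (dart_in p).
Proof. exact: (f_iinv (edge_in_codom_out p)). Qed.

Lemma prev_strand_inj : injective prev_strand.
Proof.
by move=> p p' e; apply: dart_in_edge_inj; rewrite /= -!prev_strandP e.
Qed.

(** Every edge at a crossing has exactly two ends, one where it arrives and one
    where it departs. *)
Lemma same_edgeP d d' : d != d' -> dart_edge d = dart_edge d' ->
  exists p, (d, d') = (dart_in p, dart_out (prev_strand p))
         \/ (d, d') = (dart_out (prev_strand p), dart_in p).
Proof.
case: (dartP d) (dartP d') => p -> [] p' ->.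
- by move=> /eqP ne /dart_in_edge_inj e; case: ne; rewrite e.
- move=> _ e; exists p; left; congr (_, dart_out _).
  by apply: dart_out_edge_inj; rewrite /= prev_strandP.
- move=> _ e; exists p'; right; congr (dart_out _, _).
  by apply: dart_out_edge_inj; rewrite /= prev_strandP.
- by move=> /eqP ne /dart_out_edge_inj e; case: ne; rewrite e.
Qed.

(** ** Corners and faces *)

Let turn (d : dart) : dart := (d.1, d.2 + 1).
Let face_rel : rel dart :=
  [rel c c' | corner_next (@ends L) c c' || corner_next (@ends L) c' c].

Let face_sym : connect_sym face_rel.
Proof. by apply: sym_connect_sym => c c'; rewrite /face_rel /= orbC. Qed.

Let face (c : dart) : dart := fingraph.root face_rel c.

Lemma corner_nextE c c' : corner_next (@ends L) c c' =
  (c' != turn c) && (dart_edge c' == dart_edge (turn c)).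
Proof. by []. Qed.

Lemma face_next c c' : corner_next (@ends L) c c' -> face c = face c'.
Proof.
move=> cc'; apply/(fingraph.rootP face_sym)/connect1.
by rewrite /face_rel /= cc'.
Qed.

Let unturn (d : dart) : dart := (d.1, d.2 - 1).

Let turnK : cancel turn unturn.
Proof. by case=> x i; rewrite /turn /unturn /= addrK. Qed.
Let unturnK : cancel unturn turn.
Proof. by case=> x i; rewrite /turn /unturn /= subrK. Qed.

(** The corners to the right and to the left of an edge are each seen from
    both of its ends. *)
Lemma face_edge p (c := dart_in p) (d := dart_out (prev_strand p)) :
  face (unturn c) = face d /\ face (unturn d) = face c.
Proof.
split; apply: face_next; rewrite corner_nextE unturnK.
  by rewrite eq_sym dart_in_out /= /d prev_strandP.
by rewrite dart_in_out /= /d prev_strandP.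
Qed.

(** ** The two coboundary maps modulo 2 *)

(* An edge is named by the strand that arrives along it. *)
Let vertex_edge (x : 'I_n) (p : strand) : bool :=
  (x == p.1) + (x == (prev_strand p).1).

Let face_type : finType := {c : dart | fingraph.roots face_rel c}.

Let edge_face (p : strand) (f : face_type) : bool :=
  (face (dart_in p) == val f) + (face (unturn (dart_in p)) == val f).

Let card_face : #|{: face_type}| = nfaces (@ends L).
Proof. by rewrite card_sig; apply: eq_card => c; rewrite !inE andbT. Qed.

Let comp_type : finType :=
  {x : 'I_n | fingraph.roots (crossing_adj (@ends L)) x}.

Let card_comp : #|{: comp_type}| = n_comp (crossing_adj (@ends L)) predT.
Proof. by rewrite card_sig; apply: eq_card => x; rewrite !inE andbT. Qed.

Let adj_sym : connect_sym (crossing_adj (@ends L)).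
Proof.
apply: sym_connect_sym => x y; apply/idP/idP => /existsP[i /existsP[j /eqP e]];
by apply/existsP; exists j; apply/existsP; exists i; rewrite e.
Qed.

Let const_adj (w : 'I_n -> bool) :
  (forall p, w p.1 = w (prev_strand p).1) ->
  (forall k : comp_type, w (val k) = 0) -> forall x, w x = 0.
Proof.
move=> wp w0 x.
have wadj y z : crossing_adj (@ends L) y z -> w y = w z.
  case/existsP=> i /existsP[j /eqP e].
  have [[-> _]//|ne] := eqVneq (y, i) (z, j).
  by have [p []] := same_edgeP ne e =>
    /(congr1 (fun t : dart * dart => (t.1.1, t.2.1)))[-> ->]; rewrite /= (wp p).
have wconn y z : connect (crossing_adj (@ends L)) y z -> w y = w z.
  case/connectP=> s ys ->; elim: s y ys => //= z' s IH y /andP[/wadj-> /IH].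
  by [].
rewrite (wconn _ _ (connect_root _ x)).
pose k : comp_type := exist (fingraph.roots _) _ (roots_root adj_sym x).
exact: (w0 k).
Qed.

Let addbb0 (b : bool) : b + b = 0. Proof. by case: b. Qed.
Let addb_eq0 (a b : bool) : a + b = 0 -> a = b. Proof. by case: a b => [] []. Qed.

Let sum_pick (T : finType) (w : T -> bool) (P : pred T) (x : T) :
  P x -> \sum_(y | P y) w y * (y == x) = w x.
Proof.
move=> Px; rewrite (bigD1 x) //= eqxx mulr1 big1 ?addr0 // => y /andP[_ /negPf->].
by rewrite mulr0.
Qed.

(** The kernel of the first coboundary map consists of the functions that are
    constant on the components of the projection. *)
Let rank_vertex_edge : (n <= \rank (fin_mx vertex_edge) + #|{: comp_type}|)%N.
Proof.
rewrite -[X in (X <= _)%N]card_ord; apply: leq_card_rank => w wg.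
apply: const_adj => p; apply: addb_eq0; rewrite -[RHS](wg p) /vertex_edge.
by under eq_bigr do rewrite mulrDr; rewrite big_split /= !sum_pick.
Qed.

(** A function on the faces that takes the same value on both sides of each edge
    is constant on each component; so the transpose of the second coboundary
    map has a kernel of dimension at most the number of components. *)
Let rank_edge_face :
  (#|{: face_type}| <= \rank (fin_mx edge_face) + #|{: comp_type}|)%N.
Proof.
rewrite -mxrank_tr.
have -> : (fin_mx edge_face)^T = fin_mx (fun f p => edge_face p f).
  by apply/matrixP => i j; rewrite !mxE.
pose fc c : face_type :=
  exist (fingraph.roots face_rel) (face c) (roots_root face_sym c).
apply: (leq_card_rank (z := fun k => fc (val k, 0))) => w wh w0.
pose W c := w (fc c).
have Wface c c' : face c = face c' -> W c = W c'.
  by move=> e; congr w; apply: val_inj.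
have sum_face c : \sum_f w f * (face c == val f) = W c.
  under eq_bigr => f _ do rewrite [face _ == _]eq_sym.
  exact: (sum_pick w (x := fc c) isT).
have Win p : W (dart_in p) = W (unturn (dart_in p)).
  apply: addb_eq0; rewrite -[RHS](wh p) /edge_face.
  by under eq_bigr do rewrite mulrDr; rewrite big_split /= !sum_face.
have Wdart d : W d = W (unturn d).
  have Wout p : W (dart_out (prev_strand p)) = W (unturn (dart_out (prev_strand p))).
    have [e1 e2] := face_edge p.
    by rewrite -(Wface _ _ e1) (Wface _ _ e2) Win.
  case: (dartP d) => p ->; first exact: Win.
  by rewrite -(f_invF prev_strand_inj p); exact: Wout.
have Wx x i : W (x, i) = W (x, 0).
  case: i => k; elim: k => [|k IH] lek; first by congr (W (_, _)); apply: val_inj.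
  rewrite Wdart -(IH (ltnW lek)); congr (W (_, _)); apply: val_inj => /=.
  by case: k lek {IH} => [|[|[|[|]]]].
have W0 : forall x, W (x, 0) = 0.
  apply: const_adj => [p|k]; last exact: w0.
  rewrite -(Wx p.1 (dart_in p).2) -(Wx (prev_strand p).1 (dart_out (prev_strand p)).2).
  have [e _] := face_edge p; rewrite -[RHS](Wface _ _ e).
  by rewrite -Wdart.
case=> c rc; have -> : exist (fingraph.roots face_rel) c rc = fc c.
  by apply: val_inj; rewrite /= /face (eqP rc).
by rewrite -[w _]/(W c); case: c {rc} => x i; rewrite Wx W0.
Qed.

Let sum_pair (A B : finType) (g : A * B -> bool) :
  \sum_p g p = \sum_a \sum_b g (a, b).
Proof. by rewrite pair_bigA; apply: eq_bigr => -[]. Qed.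

Let big_strands (g : dart -> bool) :
  \sum_p (g (dart_in p) + g (dart_out p)) = \sum_d g d.
Proof. by rewrite !sum_pair; apply: eq_bigr => x _; exact: big_darts. Qed.

Let sum_prev (g : strand -> bool) : \sum_p g (prev_strand p) = \sum_p g p.
Proof.
have bij : bijective prev_strand by exact: injF_bij prev_strand_inj.
by rewrite [RHS](reindex prev_strand) //=; exact: onW_bij.
Qed.

(** Around a crossing, each corner is met once from each of the two ends that
    bound it. *)
Let vertex_edge_face x f : \sum_p vertex_edge x p * edge_face p f = 0.
Proof.
pose g d : bool := (face d == val f) + (face (unturn d) == val f).
have gprev p : g (dart_in p) = g (dart_out (prev_strand p)).
  by have [e1 e2] := face_edge p; rewrite /g e1 e2 addrC.
transitivity (\sum_p (x == p.1) * (g (dart_in p) + g (dart_out p))).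
  under eq_bigr do rewrite mulrDl.
  under [RHS]eq_bigr do rewrite mulrDr.
  rewrite !big_split /=; congr (_ + _).
  rewrite -(sum_prev (fun p => (x == p.1) * g (dart_out p))).
  by apply: eq_bigr => p _; rewrite -gprev.
transitivity (\sum_i g (x, i)).
  rewrite -big_darts sum_pair.
  rewrite (bigD1 x) //= eqxx [X in _ + X]big1 ?addr0 => [|y /negPf nyx].
    by apply: eq_bigr => b _; rewrite mul1r.
  by rewrite big1 // => b _; rewrite eq_sym nyx mul0r.
rewrite /g big_split /= [X in _ + X](reindex_inj (addIr 1)) /=.
under [X in _ + X]eq_bigr do rewrite /unturn /= addrK.
exact: addbb0.
Qed.

Let parity (d : dart) : bool := odd d.2.

Let parity_unturn d : parity (unturn d) = 1 + parity d.
Proof. by case: d => x [[|[|[|[|//]]]] ?]. Qed.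

(** A closed walk around a face reads the parities of the two ends of each edge
    it follows; as it turns by one corner at each crossing, these contributions
    cancel in pairs. *)
Let parity_face f :
  \sum_p (1 + parity (dart_in p) + parity (dart_out (prev_strand p))) *
     edge_face p f = 0.
Proof.
pose k d : bool := (face d == val f) * parity d.
pose g d := k d + k (unturn d).
transitivity (\sum_p (g (dart_in p) + g (dart_out p))).
  rewrite big_split /= -[X in _ + X]sum_prev -big_split /=.
  apply: eq_bigr => p _; rewrite /g /k /edge_face !parity_unturn.
  have [-> ->] := face_edge p.
  by do 4?[case: (_ == _) | case: (parity _)].
rewrite big_strands /g big_split /= [X in _ + X](reindex_inj (can_inj turnK)) /=.
under [X in _ + X]eq_bigr do rewrite turnK.
exact: addbb0.
Qed.

(** The projection can be oriented so that, around each crossing, its edges lead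
    alternately in and out: [u x (+) odd i] tells whether the edge at the end i
    of x leads into x.  The obstruction is the sum of [1 + parity + parity] over
    the edges of a closed walk.  It vanishes around faces, and this suffices,
    because on a sphere every cocycle modulo 2 is a coboundary.  The latter is Euler's
    formula: the ranks of the two coboundary maps add up to the number of
    edges. *)
Theorem source_sink : exists u : 'I_n -> bool,
  forall d d', d != d' -> dart_edge d = dart_edge d' ->
    u d.1 (+) odd d.2 != u d'.1 (+) odd d'.2.
Proof.
have [|u uP] := exact_of_rank vertex_edge_face _ parity_face.
  apply: (@leq_trans (n * 2)); first by rewrite card_prod card_ord card_bool.
  have fE : #|{: face_type}| = (n + 2 * #|{: comp_type}|)%N.
    by rewrite card_face card_comp (@ends_planar L).
  have := rank_vertex_edge; have := leq_trans (eq_leq (esym fE)) rank_edge_face.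
  lia.
have uin p : u p.1 (+) odd (dart_in p).2 !=
    u (prev_strand p).1 (+) odd (dart_out (prev_strand p)).2.
  have := uP p; rewrite /vertex_edge; under eq_bigr do rewrite mulrDr.
  rewrite big_split /= !sum_pick //=.
  suff: forall a b c d : bool, 1 + a + b = c + d -> c (+) a != d (+) b by apply.
  by do 4!case.
exists u => d d' ne e.
have [p [] [-> ->] /=] := same_edgeP ne e; first exact: uin.
by rewrite eq_sym; exact: uin.
Qed.

End Orientation.
(** * Smoothings as permutations of the edges *)

Lemma mem_porbit_fconnect (T : finType) (s : {perm T}) x y :
  (y \in porbit s x) = fconnect s x y.
Proof.
apply/porbitP/idP => [[i ->]|/iter_findex <-]; first by rewrite permX fconnect_iter.
by exists (findex s x y); rewrite permX.
Qed.

Lemma card_porbits (T : finType) (s : {perm T}) : #|porbits s| = fcard s predT.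
Proof.
have sym : connect_sym (frel s) by exact: fconnect_sym perm_inj.
have porbit_eq x y : (porbit s x == porbit s y) = fconnect s x y.
  by rewrite eq_porbit_mem porbit_sym mem_porbit_fconnect.
transitivity #|porbit s @: [set x | froots s x]|.
  apply: eq_card => X; apply/imsetP/imsetP => -[x _ ->]; last by exists x.
  exists (froot s x); first by rewrite inE roots_root.
  by apply/eqP; rewrite porbit_eq connect_root.
rewrite card_in_imset => [|x y]; first by apply: eq_card => x; rewrite !inE andbT.
rewrite !inE => /eqP rx /eqP ry /eqP; rewrite porbit_eq => /(fingraph.rootP sym).
by rewrite rx ry.
Qed.

Section Smoothings.
Variable L : link_projection.
Let n := ncr L.
Let E := edge L.
Let dart : finType := ('I_n * 'Z_4)%type.
Implicit Types (al : vertex L) (x : 'I_n) (d : dart).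

(** The involution that exchanges the ends joined by the smoothing b. *)
Definition arc_end (b : bool) (i : 'Z_4) : 'Z_4 := if b == odd i then i + 1 else i - 1.

Definition arc_dart al d : dart := (d.1, arc_end (al d.1) d.2).

Lemma arc_endK b : involutive (arc_end b).
Proof. by case: b => -[[|[|[|[|//]]]] ?]; apply: val_inj. Qed.

Lemma odd_arc_end b i : odd (arc_end b i) = ~~ odd i.
Proof. by case: b i => [] [[|[|[|[|//]]]] ?]. Qed.

Lemma arc_dartK al : involutive (arc_dart al).
Proof. by case=> x i; rewrite /arc_dart /= arc_endK. Qed.

Lemma on_cycleP al a b :
  reflect (exists d, a = dart_edge d /\ b = dart_edge (arc_dart al d))
          (on_cycle al a b).
Proof.
pose arcs := flatten [seq smoothing (@ends L x) (al x) | x <- enum 'I_n].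
have arcsP a' b' : (a', b') \in arcs ->
    exists d, a' = dart_edge d /\ b' = dart_edge (arc_dart al d).
  case/flattenP=> s /mapP[x _ ->]; rewrite /smoothing.
  by case alx: (al x); rewrite !inE => /orP[]/eqP[-> ->];
    [exists (x, 1) | exists (x, 3) | exists (x, 0) | exists (x, 2)];
    split; rewrite // /arc_dart /= alx; congr (@ends L x _); apply: val_inj.
apply: (iffP idP) => [/orP[/arcsP//|/arcsP[d [-> ->]]]|[[x i] [-> ->]]].
  by exists (arc_dart al d); rewrite arc_dartK.
have mem_arcs p : p \in smoothing (@ends L x) (al x) -> p \in arcs.
  by move=> px; apply/flattenP; exists (smoothing (@ends L x) (al x)) => //;
    apply/map_f; rewrite mem_enum.
rewrite /on_cycle /linked -/arcs /dart_edge /arc_dart /=.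
have [alx|alx] := eqVneq (al x) (odd i).
  rewrite mem_arcs // /smoothing alx; case: i {alx} => [[|[|[|[|//]]]] lti] /=;
  rewrite !inE /=; apply/orP;
  (try by left; apply/eqP; congr pair; congr (@ends L x _); apply: val_inj);
  by right; apply/eqP; congr pair; congr (@ends L x _); apply: val_inj.
rewrite [X in _ || X]mem_arcs ?orbT // /smoothing.
have -> : al x = ~~ odd i by case: (al x) (odd i) alx => [] [].
case: i {alx} => [[|[|[|[|//]]]] lti] /=;
  rewrite !inE /=; apply/orP;
  (try by left; apply/eqP; congr pair; congr (@ends L x _); apply: val_inj);
  by right; apply/eqP; congr pair; congr (@ends L x _); apply: val_inj.
Qed.

Lemma on_cycle_sym al : connect_sym (on_cycle al).
Proof.
by apply: sym_connect_sym => a b; apply/idP/idP; rewrite /on_cycle /linked orbC.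
Qed.

Lemma on_cycle_arc al d : on_cycle al (dart_edge d) (dart_edge (arc_dart al d)).
Proof. by apply/on_cycleP; exists d. Qed.

Lemma other_dart d : exists2 d', d != d' & dart_edge d = dart_edge d'.
Proof.
case: (dartP d) => p ->.
  by exists (dart_out (prev_strand p)); rewrite ?dart_in_out ?prev_strandP.
exists (dart_in (invF (@prev_strand_inj L) p)); first by rewrite eq_sym dart_in_out.
by rewrite -prev_strandP f_invF.
Qed.

Section Oriented.
Variable u : 'I_n -> bool.
Variable uP : forall d d', d != d' -> dart_edge d = dart_edge d' ->
  u d.1 (+) odd d.2 != u d'.1 (+) odd d'.2.

Let head d := u d.1 (+) odd d.2.

Let head_arc al d : head (arc_dart al d) = ~~ head d.
Proof. by rewrite /head odd_arc_end addbN. Qed.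

Let head_inj d d' : head d = head d' -> dart_edge d = dart_edge d' -> d = d'.
Proof.
move=> h e; apply/eqP; apply: contraT => ne.
by have := uP ne e; rewrite -/(head d) h eqxx.
Qed.

(** In the source-sink orientation, an edge that is at some crossing leads into
    exactly one end of a crossing, and both smoothings join this end to the start
    of an edge.  Crossingless circles are fixed. *)
Let next al (e : E) : E :=
  if [pick d | head d && (dart_edge d == e)] is Some d
  then dart_edge (arc_dart al d) else e.

Let next_head al d : head d -> next al (dart_edge d) = dart_edge (arc_dart al d).
Proof.
move=> hd; rewrite /next; case: pickP => [d' /andP[hd' /eqP e]|/(_ d)].
  by rewrite (head_inj (etrans hd' (esym hd)) e).
by rewrite hd eqxx.
Qed.

Variant next_spec al (e : E) : E -> Type :=
  | NextHead d of head d & e = dart_edge d :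
      next_spec al e (dart_edge (arc_dart al d))
  | NextCircle of (forall d, dart_edge d != e) : next_spec al e e.

Let nextP al e : next_spec al e (next al e).
Proof.
rewrite /next; case: pickP => [d /andP[hd /eqP de]|nod]; first exact: NextHead.
apply: NextCircle => d; apply/eqP => de.
have [d' ne e'] := other_dart d; have := nod d; have := nod d'.
rewrite -e' de eqxx !andbT => hd' hd.
by have := uP ne e'; rewrite -/(head d) -/(head d') hd hd'.
Qed.

Let next_inj al : injective (next al).
Proof.
move=> e e'.
case: (nextP al e) => [d hd ->|nd]; case: (nextP al e') => [d' hd' ->|nd'] //.
- move=> /head_inj; rewrite !head_arc hd hd' => /(_ erefl) /(congr1 (arc_dart al)).
  by rewrite !arc_dartK => ->.
- by move=> e1; have := nd' (arc_dart al d); rewrite e1 eqxx.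
- by move=> e1; have := nd (arc_dart al d'); rewrite -e1 eqxx.
Qed.

Let next_perm al : {perm E} := perm (@next_inj al).

Let next_permE al e : next_perm al e = next al e.
Proof. exact: permE. Qed.

Let connect_next al : connect (on_cycle al) =2 fconnect (next_perm al).
Proof.
have nsym : connect_sym (frel (next_perm al)) by exact: fconnect_sym perm_inj.
move=> a b; apply/idP/idP; apply: connect_sub => {}a {}b.
  move=> /on_cycleP[d [-> ->]].
  case hd: (head d); first by rewrite -next_head // -next_permE; exact: fconnect1.
  rewrite nsym -{2}[d](arc_dartK al) -(@next_head al (arc_dart al d)) ?head_arc ?hd //.
  by rewrite -next_permE; exact: fconnect1.
move=> /= /eqP <-; rewrite next_permE; case: nextP => // d _ ->.
exact/connect1/on_cycle_arc.
Qed.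

Let cube_arc_other al x d : d.1 != x -> arc_dart (cube_head (al, x)) d = arc_dart al d.
Proof. by case: d => y i /= /negPf yx; rewrite /arc_dart /= ffunE /= yx. Qed.

(** The arc that starts at an end after the change of smoothing stops where the
    arc from the opposite end stopped before. *)
Let cube_arc_at al x i : ~~ al x ->
  arc_dart (cube_head (al, x)) (x, i) = arc_dart al (x, i + 2).
Proof.
move=> /negPf alx; rewrite /arc_dart /= ffunE /= eqxx alx /=; congr (x, _).
by case: i => [[|[|[|[|//]]]] ?]; apply: val_inj.
Qed.

(** Edges lead into the crossing x at its opposite ends [ui x] and [ui x + 2]. *)
Let ui x : 'Z_4 := if u x then 0 else 1.

Let head_ui x i : head (x, i) = (i == ui x) || (i == ui x + 2).
Proof. by rewrite /head /ui /=; case: (u x) i => [] [[|[|[|[|//]]]] ?]. Qed.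

Let next_perm_cube al x : ~~ al x ->
  next_perm (cube_head (al, x)) =
  (tperm (dart_edge (x, ui x)) (dart_edge (x, ui x + 2)) * next_perm al)%g.
Proof.
move=> alx; apply/permP => e; rewrite permM !next_permE.
have h1 : head (x, ui x) by rewrite head_ui eqxx.
have h2 : head (x, ui x + 2) by rewrite head_ui eqxx orbT.
have [d hd ->|nd] := nextP (cube_head (al, x)) e; last first.
  rewrite tpermD ?nd //; case: nextP => // d hd de.
  by have := nd d; rewrite -de eqxx.
have [|dx] := boolP (d.1 == x); last first.
  rewrite cube_arc_other // tpermD ?next_head //.
    by apply: contraNneq dx => /head_inj<- //; rewrite h1 hd.
  by apply: contraNneq dx => /head_inj<- //; rewrite h2 hd.
case: d hd => y i hd /= /eqP yx; rewrite {y}yx in hd *.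
rewrite cube_arc_at //; move: hd; rewrite head_ui => /orP[]/eqP->.
  by rewrite tpermL next_head.
rewrite tpermR next_head //; congr (dart_edge (arc_dart al (x, _))).
by rewrite -addrA (_ : 2 + 2 = 0 :> 'Z_4) ?addr0 //; apply: val_inj.
Qed.

(** Each of the ends 0 and 2 is joined at x to one of the ends that edges lead
    into, or is one of them. *)
Let ends_head al x (C := connect (on_cycle al)) :
  C (@ends L x 0) (@ends L x 2) = C (dart_edge (x, ui x)) (dart_edge (x, ui x + 2)).
Proof.
rewrite /ui /dart_edge; case: (u x) => /=.
  by congr (C (@ends L x _) (@ends L x _)); apply: val_inj.
have arcC i : C (@ends L x i) =1 C (@ends L x (arc_end (al x) i)).
  apply: same_connect1; first exact: on_cycle_sym.
  exact: (on_cycle_arc al (x, i)).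
have swap a b : C a b = C b a by apply: on_cycle_sym.
have e4 (i j : 'Z_4) : i = j :> nat -> @ends L x i = @ends L x j.
  by move=> ij; congr (@ends L x _); apply: val_inj.
rewrite arcC swap arcC; case: (al x); last first.
  by rewrite swap; congr (C _ _); apply: e4.
by congr (C _ _); apply: e4.
Qed.

(** Multiplying a permutation by a transposition either splits a cycle that
    contains both transposed points or merges the two cycles that contain
    them. *)
Lemma oriented_bifurcation al x : ~~ al x ->
  let al' := cube_head (al, x) in
  let cyc a := connect (on_cycle a) (@ends L x 0) (@ends L x 2) in
  cyc al' = ~~ cyc al /\
  (n_comp (on_cycle al') predT + (~~ cyc al).*2 =
   n_comp (on_cycle al) predT + 1)%N.
Proof.
move=> alx al' cyc; set h1 := dart_edge (x, ui x); set h2 := dart_edge (x, ui x + 2).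
have h12 : h1 != h2.
  apply/eqP => /head_inj; rewrite !head_ui !eqxx orbT => /(_ erefl) [].
  by rewrite /ui; case: (u x).
have compE a : n_comp (on_cycle a) predT = #|porbits (next_perm a)|.
  by rewrite card_porbits; apply: eq_n_comp; exact: connect_next.
have cycE a : cyc a = (h2 \in porbit (next_perm a) h1).
  by rewrite mem_porbit_fconnect -connect_next /cyc ends_head.
have mulE : next_perm al' = (tperm h1 h2 * next_perm al)%g by exact: next_perm_cube.
have mulE' : next_perm al = (tperm h1 h2 * next_perm al')%g.
  by rewrite mulE mulgA tperm2 mul1g.
have := porbits_mul_tperm (next_perm al) h1 h2; rewrite /= -mulE h12.
have := porbits_mul_tperm (next_perm al') h1 h2; rewrite /= -mulE' h12.
rewrite !(porbit_sym _ h1) -!cycE !compE.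
by case: (cyc al) (cyc al') => [] []; rewrite /= -!addnn; lia.
Qed.

End Oriented.

(** Exactly one of the two smoothings has both arcs at x on the same cycle; in
    particular, no change of smoothing turns one cycle into one cycle. *)
Theorem bifurcation al x : ~~ al x ->
  let al' := cube_head (al, x) in
  let cyc a := connect (on_cycle a) (@ends L x 0) (@ends L x 2) in
  cyc al' = ~~ cyc al /\
  (n_comp (on_cycle al') predT + (~~ cyc al).*2 =
   n_comp (on_cycle al) predT + 1)%N.
Proof. by have [u uP] := source_sink L; exact: (@oriented_bifurcation u uP). Qed.

(** The cycles of al' are those of al, except that all cycles of al through x are
    parts of a single one.  Nothing is assumed on which of al and al' is the
    tail, so that the lemma describes merges forwards and splits backwards. *)
Lemma merge_cycles al al' x (C := connect (on_cycle al))
    (C' := connect (on_cycle al')) (x0 := @ends L x 0) (x2 := @ends L x 2) :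
  (forall y, y != x -> al y = al' y) -> C' x0 x2 ->
  forall a b, C' a b = C a b || (C a x0 || C a x2) && (C b x0 || C b x2).
Proof.
move=> agree C'x a b.
have Csym a' b' : C a' b' = C b' a' by exact: on_cycle_sym.
have C'sym a' b' : C' a' b' = C' b' a' by exact: on_cycle_sym.
have Ctr : transitive C by exact: connect_trans.
have C'tr : transitive C' by exact: connect_trans.
have arc_agree d : d.1 != x -> arc_dart al' d = arc_dart al d.
  by move=> dx; rewrite /arc_dart agree.
have ends4 be i (D := connect (on_cycle be)) : D (@ends L x i) x0 || D (@ends L x i) x2.
  have e4 (k j : 'Z_4) : k = j :> nat -> @ends L x k = @ends L x j.
    by move=> kj; congr (@ends L x _); apply: val_inj.
  have D02 k : k = 0 \/ k = 2 -> D (@ends L x k) x0 || D (@ends L x k) x2.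
    by case=> ->; rewrite /D connect0 ?orbT.
  have Darc k : D (@ends L x k) =1 D (@ends L x (arc_end (be x) k)).
    apply: same_connect1; first exact: on_cycle_sym.
    exact: (on_cycle_arc be (x, k)).
  case oddi: (odd i); [rewrite (Darc i) (Darc i)|]; apply: D02; move: oddi.
    by case: (be x) i => [] [[|[|[|[|//]]]] ?] // _; (try by left; apply: val_inj);
       by right; apply: val_inj.
  by case: i => [[|[|[|[|//]]]] ?] // _; (try by left; apply: val_inj);
     by right; apply: val_inj.
have C'x0 c : C' c x0 || C' c x2 -> C' c x0.
  by case/orP => // cx2; apply: C'tr cx2 _; rewrite C'sym.
have subC : subrel C C'.
  apply: connect_sub => {a b}_ _ /on_cycleP[d [-> ->]].
  have [dx|dx] := eqVneq d.1 x; last first.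
    by rewrite -arc_agree //; exact/connect1/on_cycle_arc.
  case: d dx => y i /= ->; rewrite /arc_dart /dart_edge /=.
  apply: (C'tr x0); first exact/C'x0/ends4.
  by rewrite C'sym; exact/C'x0/ends4.
apply/idP/idP; last first.
  case/orP => [/subC//|/andP[ax bx]]; apply: (C'tr x0).
    by apply: C'x0; case/orP: ax => /subC->; rewrite ?orbT.
  by rewrite C'sym; apply: C'x0; case/orP: bx => /subC->; rewrite ?orbT.
case/connectP=> s sP ->{b}; elim: s a sP => [|c s IH] a /=.
  by rewrite /C connect0.
case/andP=> ac /IH; move: (last c s) => b.
have PC c1 c2 : C c1 c2 -> (C c1 x0 || C c1 x2) = (C c2 x0 || C c2 x2).
  move=> cc; have Ceq : C c1 =1 C c2.
    exact: (same_connect (@on_cycle_sym al) cc).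
  by rewrite !Ceq.
have [|nCac] := boolP (C a c).
  move=> Cac; rewrite -(PC _ _ Cac) => /orP[Ccb|->]; last by rewrite orbT.
  by rewrite (Ctr _ _ _ Cac Ccb).
have /andP[Pa Pc] : (C a x0 || C a x2) && (C c x0 || C c x2).
  case/on_cycleP: ac nCac => d [-> ->] nC.
  have [dx|dx] := eqVneq d.1 x; last first.
    by move: nC; rewrite arc_agree // /C connect1 // on_cycle_arc.
  by case: d dx nC => y i /= -> _; rewrite /dart_edge /= !ends4.
by rewrite Pa Pc /= => /orP[/PC<-|->]; rewrite ?Pc orbT.
Qed.

End Smoothings.
(** * Monomials in the cycles of a smoothing *)

Lemma forall_off_classes (T : finType) (C : rel T) (Q : pred T) (x0 x2 : T) :
  (forall a b, C a b -> Q a = Q b) ->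
  [forall a, Q a] =
  [&& [forall (a | ~~ (C a x0 || C a x2)), Q a], Q x0 & Q x2].
Proof.
move=> QC; apply/forallP/and3P => [Qa|[/forall_inP Qoff Q0 Q2] a].
  by split=> //; apply/forall_inP => a _.
have [/orP[/QC->//|/QC->//]|/Qoff//] := boolP (C a x0 || C a x2).
Qed.

Section Monomials.
Variables (K : fieldType) (L : link_projection).
Let n := ncr L.
Let E := edge L.
Implicit Types (al : vertex L) (x : 'I_n) (S T : seq E) (t e : {ffun E -> bool}).

Let cyc al : rel E := connect (on_cycle al).

Let cyc_sym al a b : cyc al a b = cyc al b a.
Proof. exact: on_cycle_sym. Qed.

Let cyc_eq al a b : cyc al a b -> cyc al a =1 cyc al b.
Proof. exact: (same_connect (@on_cycle_sym L al)). Qed.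

Let cyc_eqr al a b c : cyc al a b -> cyc al c a = cyc al c b.
Proof. by move=> ab; rewrite ![cyc al c _]cyc_sym (cyc_eq ab). Qed.

(** Identify V_al with the algebra generated by one variable X_a for each edge
    a, with X_a ^ 2 = 0 and X_a = X_b whenever a and b lie on one cycle; v_+ and
    v_- on a cycle are 1 and its variable.  The product of the X_a for a in S
    is then a basis element or 0, and [monomial al S t] is its coefficient at
    the basis element [t]. *)
Definition monomial al S t : bool :=
  [forall c, count (cyc al c) S == ~~ t c].

Definition state_monomial al t : seq E :=
  [seq c <- enum E | fingraph.roots (on_cycle al) c & ~~ t c].

Lemma monomial_perm al S T t : perm_eq S T -> monomial al S t = monomial al T t.
Proof.
by move=> /seq.permP ST; apply: eq_forallb => c; rewrite ST.
Qed.

Lemma monomial_cons al a b S t :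
  cyc al a b -> monomial al (a :: S) t = monomial al (b :: S) t.
Proof. by move=> ab; apply: eq_forallb => c /=; rewrite (cyc_eqr _ ab). Qed.

Lemma is_stateP al t :
  reflect (forall a b, cyc al a b -> t a = t b) (is_state (al, t)).
Proof.
apply: (iffP forallP) => [tP a b ab|tP a].
  by have /forallP/(_ b)/implyP/(_ ab)/eqP := tP a.
by apply/forallP => b; apply/implyP => /tP->.
Qed.

Let roots_cyc al a b : fingraph.roots (on_cycle al) b ->
  cyc al a b = (b == fingraph.root (on_cycle al) a).
Proof.
move=> /eqP rb; rewrite eq_sym -{2}rb; apply/idP/idP.
  by rewrite root_connect //; exact: on_cycle_sym.
by rewrite root_connect //; exact: on_cycle_sym.
Qed.

Let count_roots al (P : pred E) a : (forall b c, cyc al b c -> P b = P c) ->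
  count (cyc al a) [seq c <- enum E | fingraph.roots (on_cycle al) c & P c] = P a.
Proof.
move=> Pcyc; rewrite count_filter.
have ra : cyc al a (fingraph.root (on_cycle al) a) by exact: connect_root.
rewrite (eq_count (a2 := fun c => P a && (c == fingraph.root (on_cycle al) a))).
  case: (P a) => /=; last by rewrite count_pred0.
  rewrite (eq_count (a2 := pred1 (fingraph.root (on_cycle al) a))) //.
  by rewrite count_uniq_mem ?enum_uniq // mem_enum.
move=> c /=; have [rc|rc] := boolP (fingraph.roots _ c); rewrite ?andbF /=.
  rewrite roots_cyc // andbC; case: eqP => [->|]; rewrite ?andbF ?andbT //=.
  by rewrite (Pcyc _ _ ra).
by case: eqP rc => [->|]; rewrite ?andbF // roots_root //; exact: on_cycle_sym.
Qed.

(** Each basis element is a monomial, with one variable for each cycle that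
    carries v_-. *)
Lemma state_monomialE al t t' : is_state (al, t) ->
  monomial al (state_monomial al t) t' = (t' == t).
Proof.
move=> /is_stateP tP.
have ct c : count (cyc al c) (state_monomial al t) = ~~ t c.
  by apply: count_roots => a b /tP->.
apply/forallP/eqP => [t'P|-> c]; last by rewrite ct.
apply/ffunP => c; have := t'P c; rewrite ct.
by case: (t c) (t' c) => [] [].
Qed.

(** A cycle contributes 1, minus 2 if the monomial contains its variable. *)
Lemma monomial_deg al S t : monomial al S t ->
  \sum_(a | fingraph.roots (on_cycle al) a) (if t a then 1 else -1 : int) =
  (n_comp (on_cycle al) predT)%:Z - 2 * (size S)%:Z.
Proof.
move/forallP => tP.
have -> : (n_comp (on_cycle al) predT)%:Z =
    \sum_(a | fingraph.roots (on_cycle al) a) 1.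
  by rewrite sumr_const natz; congr Posz; apply: eq_card => a; rewrite !inE andbT.
have -> : (size S)%:Z =
    \sum_(a | fingraph.roots (on_cycle al) a) (count (cyc al a) S)%:Z.
  transitivity (\sum_(b <- S) (1 : int)).
    by rewrite big_const_seq count_predT iter_addr_0 natz.
  under [RHS]eq_bigr do rewrite -sum1_count big_mkcond -natz raddf_sum /=.
  rewrite exchange_big /=; apply: eq_bigr => b _.
  rewrite (bigD1 (fingraph.root (on_cycle al) b)) /=; last first.
    by apply: roots_root; exact: on_cycle_sym.
  rewrite cyc_sym [cyc _ _ _]connect_root big1 ?addr0 // => a /andP[ra /negPf ne].
  by rewrite cyc_sym roots_cyc // ne.
rewrite mulr_sumr -sumrB; apply: eq_bigr => a _.
by rewrite (eqP (tP a)); case: (t a).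
Qed.

(** ** The edge maps on monomials *)

Section EdgeMap.
Variables (al : vertex L) (x : 'I_n).
Let x0 := @ends L x 0.
Let x2 := @ends L x 2.
Let al' := cube_head (al, x).

(** The monomials whose sum is the image of the monomial S under the edge map
    at x: merging identifies the variables of two cycles, splitting is
    multiplication by the sum of the variables of the two new cycles. *)
Definition edge_image S : seq (seq E) :=
  if cyc al x0 x2 then [:: x0 :: S; x2 :: S] else [:: S].

Let state_of S : {ffun E -> bool} := [ffun c => count (cyc al c) S == 0%N].

Let squarefree S := [forall c, (count (cyc al c) S <= 1)%N].

Let monomialE S e : monomial al S e = squarefree S && (e == state_of S).
Proof.
apply/forallP/andP => [eP|[/forallP sf /eqP-> c]].
  split; first by apply/forallP => c; rewrite (eqP (eP c)); case: (e c).
  by apply/eqP/ffunP => c; rewrite ffunE (eqP (eP c)); case: (e c).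
by rewrite ffunE; have := sf c; case: (count _ _) => [|[|]].
Qed.

Let count_cyc_eq S a b : cyc al a b -> count (cyc al a) S = count (cyc al b) S.
Proof. by move=> ab; apply: eq_count; exact: cyc_eq. Qed.

Let is_state_of S : is_state (al, state_of S).
Proof.
by apply/is_stateP => a b ab; rewrite !ffunE (count_cyc_eq _ ab).
Qed.

Variable alx : ~~ al x.

Let cyc' := cyc al'.

Let bifurcate : cyc' x0 x2 = ~~ cyc al x0 x2.
Proof. by have [] := bifurcation alx. Qed.

Let agree y : y != x -> al y = al' y.
Proof. by rewrite ffunE /= => /negPf->. Qed.

Let P a := cyc al a x0 || cyc al a x2.

(** The cycles through x cover the same edges before and after the change, so
    that one predicate P serves both ends of the edge of the cube. *)
Let P' a : cyc' a x0 || cyc' a x2 = P a.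
Proof.
rewrite /P /cyc'; have [c02|nc02] := boolP (cyc al x0 x2).
  have m := @merge_cycles L al' al x (fun y yx => esym (agree yx)) c02.
  have := m a x0; have := m a x2.
  rewrite -![connect _]/(cyc _) -/x0 -/x2 => -> ->.
  rewrite ![cyc al' x0 x0]connect0 ![cyc al' x2 x2]connect0.
  by rewrite orbT !andbT /=; case: (cyc _ a x0); case: (cyc _ a x2).
have c02' : cyc' x0 x2 by rewrite bifurcate.
have m := @merge_cycles L al al' x agree c02'.
have := m a x0; have := m a x2.
rewrite -![connect _]/(cyc _) -/x0 -/x2 => -> ->.
rewrite ![cyc al x0 x0]connect0 ![cyc al x2 x2]connect0.
by rewrite orbT !andbT /=; case: (cyc _ a x0); case: (cyc _ a x2).
Qed.

Let cyc_off a : ~~ P a -> cyc' a =1 cyc al a.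
Proof.
move=> nPa b; rewrite /cyc'; have [c02|nc02] := boolP (cyc al x0 x2).
  have := @merge_cycles L al' al x (fun y yx => esym (agree yx)) c02 a b.
  by rewrite -![connect _]/(cyc _) -/x0 -/x2 -/cyc' P' (negPf nPa) orbF.
have c02' : cyc' x0 x2 by rewrite bifurcate.
have := @merge_cycles L al al' x agree c02' a b.
by rewrite -![connect _]/(cyc _) -/x0 -/x2 -/cyc' -/(P a) (negPf nPa) orbF.
Qed.

(** Before a split and after a merge, there is just one cycle through x. *)
Let cyc_merge b :
  (if cyc al x0 x2 then cyc al x0 b else cyc' x0 b) = P b.
Proof.
have xx be a : cyc be a a by exact: connect0.
have [c02|nc02] := boolP (cyc al x0 x2).
  by rewrite /P -(cyc_eqr _ c02) orbb cyc_sym.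
have c02' : cyc' x0 x2 by rewrite bifurcate.
by rewrite -P' /cyc' -(cyc_eqr _ c02') orbb cyc_sym.
Qed.

Let off S e' := [forall (a | ~~ P a), count (cyc al a) S == ~~ e' a].

Let monomial_head S e' : is_state (al', e') ->
  monomial al' S e' =
  [&& [forall (a | ~~ P a), count (cyc al a) S == ~~ e' a],
      count (cyc' x0) S == ~~ e' x0 & count (cyc' x2) S == ~~ e' x2].
Proof.
move=> /is_stateP e'P; rewrite /monomial (@forall_off_classes _ cyc' _ x0 x2).
  congr (_ && _); apply: eq_forallb => a; rewrite P'.
  by have [//|/cyc_off e] := boolP (P a); rewrite (eq_count e).
by move=> a b ab; rewrite (e'P _ _ ab) (eq_count (cyc_eq ab)).
Qed.

Let off_cons S e' a : P a -> off (a :: S) e' = off S e'.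
Proof.
move=> Pa; apply: eq_forallb => b; have [//|nPb] := boolP (P b) => /=.
suff -> : cyc al b a = false by rewrite add0n.
apply: contraNF nPb => ba; rewrite /P.
by rewrite !(cyc_eq ba).
Qed.

Let squarefree_coef S e' : is_state (al', e') ->
  (squarefree S)%:R * dxi_coef K (al, x) (state_of S) e' =
  if [&& off S e', count (cyc al x0) S <= 1 & count (cyc al x2) S <= 1]%N then
    if cyc al x0 x2
    then Delta_coef K (count (cyc al x0) S == 0%N) (e' x2) (e' x0)
    else m_coef K (count (cyc al x0) S == 0%N) (count (cyc al x2) S == 0%N) (e' x0)
  else 0.
Proof.
move=> /is_stateP e'P.
have e'4 (i j : 'Z_4) d : dart_edge (x, i) = dart_edge d ->
    @ends L x j = dart_edge (arc_dart al' d) -> e' (@ends L x i) = e' (@ends L x j).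
  move=> ei ej; apply: e'P; rewrite ej -[@ends L x i]/(dart_edge (x, i)) ei.
  exact/connect1/on_cycle_arc.
have al'x : al' x = true by rewrite ffunE /= eqxx.
have e1 : e' (@ends L x 1) = e' x2.
  apply: (e'4 1 2 (x, 1)) => //; rewrite /arc_dart /= al'x /=.
  by congr (@ends L x _); apply: val_inj.
have e3 : e' (@ends L x 3) = e' x0.
  apply: (e'4 3 0 (x, 3)) => //; rewrite /arc_dart /= al'x /=.
  by congr (@ends L x _); apply: val_inj.
rewrite /dxi_coef /= -[connect _]/(cyc al) -/x0 -/x2 !ffunE e1 e3.
rewrite /squarefree (@forall_off_classes _ (cyc al) _ x0 x2); last first.
  by move=> a b /count_cyc_eq->.
set sf := [forall (_ | _), _]; set c0 := count (cyc al x0) S; set c2 := count _ S.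
have offE : sf && [forall a, [|| cyc al x0 a, cyc al x2 a | e' a == state_of S a]]
    = off S e'.
  apply/andP/forall_inP => [[/forall_inP sfP /forallP eP] a nPa|offP].
    have := sfP a nPa; have := eP a.
    rewrite orbA ![cyc al _ a]cyc_sym -/(P a) (negPf nPa) /= ffunE.
    by move=> /eqP->; case: (count _ _) => [|[]].
  split; first by apply/forall_inP => a /offP/eqP->; case: (e' a).
  apply/forallP => a; rewrite orbA ![cyc al _ a]cyc_sym -/(P a).
  by have [//|/offP/eqP ce] := boolP (P a); rewrite /= ffunE ce; case: (e' a).
rewrite -offE; move: sf {offE} => sf; case: sf; rewrite /= ?mul0r //.
case: [forall _, _]; rewrite /= ?mulr0 //.
by case: (_ && _); rewrite ?mul1r ?mul0r.
Qed.

(** The table of m is the multiplication of monomials, and that of Delta is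
    multiplication by X_a + X_b, where a and b lie on the two new cycles: 1 goes
    to X_a + X_b and X_a = X_b to X_a * X_b, because squares vanish. *)
Lemma edge_map_monomial S e' : is_state (al', e') ->
  \sum_(e | is_state (al, e)) (monomial al S e)%:R * dxi_coef K (al, x) e e' =
  \sum_(T <- edge_image S) (monomial al' T e')%:R.
Proof.
move=> e'P; rewrite (bigD1 (state_of S)) ?is_state_of //= monomialE eqxx andbT.
rewrite [X in _ + X]big1 ?addr0 => [|e /andP[_ /negPf ne]]; last first.
  by rewrite monomialE ne andbF mul0r.
rewrite squarefree_coef // /edge_image.
case c02: (cyc al x0 x2); have PP b := cyc_merge b; rewrite c02 in PP.
  rewrite big_cons big_seq1 !monomial_head // -!/(off _ _).
  rewrite !off_cons; try by rewrite /P /cyc connect0 ?orbT.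
  have nc02 : cyc' x0 x2 = false by rewrite bifurcate c02.
  have nc20 : cyc' x2 x0 = false by rewrite /cyc' cyc_sym.
  rewrite -(count_cyc_eq _ c02).
  have -> : count (cyc al x0) S = (count (cyc' x0) S + count (cyc' x2) S)%N.
    rewrite -count_predUI [X in (_ + X)%N](eq_count (a2 := pred0)); last first.
      move=> b /=; apply/negP => /andP[b0 b2].
      by move: nc02; rewrite /cyc' (cyc_eqr _ b2) [cyc _ _ _]b0.
    rewrite count_pred0 addn0; apply: eq_count => b /=.
    by rewrite PP // -P' /cyc' ![cyc _ b _]cyc_sym.
  rewrite /= [cyc' x0 x0]connect0 [cyc' x2 x2]connect0 nc02 nc20 !add0n !add1n.
  (* what remains is a comparison for each value of the exponents 0, 1 and >= 2 *)
  case: (off S e') => /=; last by rewrite addr0.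
  case: (count _ S) => [|[|k]] /=; case: (count _ S) => [|[|j]] /=;
    rewrite ?addn0 ?addSn ?addnS /=;
    by case: (e' x0) (e' x2) => [] []; rewrite /= ?addr0 ?add0r.
rewrite /= big_seq1 monomial_head // -/(off _ _).
have c02' : cyc' x0 x2 by rewrite bifurcate c02.
have /is_stateP/(_ _ _ c02') e02 := e'P.
rewrite -(eq_count (cyc_eq c02')) -e02.
have -> : count (cyc' x0) S = (count (cyc al x0) S + count (cyc al x2) S)%N.
  rewrite -count_predUI [X in (_ + X)%N](eq_count (a2 := pred0)); last first.
    move=> b /=; apply/negP => /andP[b0 b2].
    by move: c02; rewrite (cyc_eqr _ b2) b0.
  rewrite count_pred0 addn0; apply: eq_count => b /=.
  by rewrite PP /P ![cyc _ b _]cyc_sym.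
case: (off S e') => //=.
case: (count _ S) => [|[|k]] /=; case: (count _ S) => [|[|j]] /=;
  rewrite ?addn0 ?addSn ?addnS /=;
  by case: (e' x0).
Qed.

End EdgeMap.
End Monomials.
(** * Squares of the cube *)

Section Squares.
Variables (K : fieldType) (L : link_projection).
Let n := ncr L.
Let E := edge L.
Implicit Types (al : vertex L) (x y : 'I_n) (S T : seq E) (e : {ffun E -> bool}).

Let cyc al : rel E := connect (on_cycle al).

Let cyc_sym al a b : cyc al a b = cyc al b a.
Proof. exact: on_cycle_sym. Qed.

Lemma cube_headC al x y :
  cube_head (cube_head (al, x), y) = cube_head (cube_head (al, y), x).
Proof. by apply/ffunP => i; rewrite !ffunE /= orbCA. Qed.

(** If the two paths around a square disagree on whether the split occurs at x or
    at y, then the cycles through x and through y are the same ones at the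
    end, so that splitting at x and splitting at y multiply by the same sum of
    variables. *)
Lemma edge_imageC al x y S e (alx := cube_head (al, x)) (aly := cube_head (al, y)) :
  ~~ al x -> ~~ al y -> x != y ->
  \sum_(T <- edge_image al x S) \sum_(T' <- edge_image alx y T)
     (monomial (cube_head (alx, y)) T' e)%:R =
  \sum_(T <- edge_image al y S) \sum_(T' <- edge_image aly x T)
     (monomial (cube_head (alx, y)) T' e)%:R :> K.
Proof.
move=> alx0 aly0 xy.
have alxy : ~~ alx y by rewrite ffunE /= negb_or eq_sym xy.
have alyx : ~~ aly x by rewrite ffunE /= negb_or xy.
have agree al1 z w : w != z -> al1 w = cube_head (al1, z) w.
  by move=> /negPf wz; rewrite ffunE /= wz.
have agree' al1 z w : w != z -> cube_head (al1, z) w = al1 w by move/agree.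
have [cycx cntx] := bifurcation alx0; have [cycxy cntxy] := bifurcation alxy.
have [cycy cnty] := bifurcation aly0; have [cycyx cntyx] := bifurcation alyx.
rewrite -!/(cyc _) -/alx -/aly in cycx cycxy cycy cycyx cntx cntxy cnty cntyx.
rewrite -(cube_headC al x y) -/alx in cycyx cntyx.
set top := cube_head (alx, y) in cycxy cntxy cycyx cntyx *.
rewrite /edge_image -!/(cyc _).
set x0 := @ends L x 0 in cycx cycyx cntx cntyx *.
set x2 := @ends L x 2 in cycx cycyx cntx cntyx *.
set y0 := @ends L y 0 in cycy cycxy cnty cntxy *.
set y2 := @ends L y 2 in cycy cycxy cnty cntxy *.
have swap a b : monomial top (a :: b :: S) e = monomial top (b :: a :: S) e.
  by apply: monomial_perm; exact: (permEl (perm_catCA [:: a] [:: b] S)).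
(* Both paths contain equally many splits: compare the numbers of cycles at their
   common ends. *)
have [[dyx bxy]|[cy dyx ax]] :
    (cyc aly x0 x2 = cyc al x0 x2 /\ cyc alx y0 y2 = cyc al y0 y2) \/
    [/\ cyc al y0 y2 = cyc al x0 x2, cyc aly x0 x2 = cyc alx y0 y2
       & cyc al x0 x2 = ~~ cyc alx y0 y2].
  have : (~~ cyc al x0 x2 + ~~ cyc alx y0 y2 = ~~ cyc al y0 y2 + ~~ cyc aly x0 x2)%N.
    move: cntx cntxy cnty cntyx; clear.
    move: (n_comp _ _) (n_comp _ _) (n_comp _ _) (n_comp _ _).
    by move: (cyc al x0 x2) (cyc alx y0 y2) (cyc al y0 y2) (cyc aly x0 x2); lia.
  move: (cyc al x0 x2) (cyc alx y0 y2) (cyc al y0 y2) (cyc aly x0 x2).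
  by do 4!case; move=> //= _; ((by left) || (by right)).
- rewrite dyx bxy; case: (cyc al x0 x2); case: (cyc al y0 y2);
    rewrite ?big_cons ?big_nil ?addr0 //.
  by rewrite (swap x0 y0) (swap x0 y2) (swap x2 y0) (swap x2 y2) addrACA.
rewrite cy dyx; case bxy: (cyc alx y0 y2) ax => ax; rewrite ax in cy; rewrite ax;
  rewrite bxy in cycxy dyx; rewrite ax in cycx; rewrite cy in cycy;
  rewrite dyx in cycyx;
  rewrite ?big_cons ?big_nil ?addr0; last first.
(* split then merge: all four ends lie on one cycle of the last smoothing *)
- have cx2 : cyc top x0 x2 by rewrite cycyx.
  have cy2 : cyc top y0 y2 by rewrite cycxy.
  have sub a b : cyc alx a b -> cyc top a b.
    by rewrite /cyc (merge_cycles (@agree alx y) cy2) => ->.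
  have : cyc top y0 x0.
    have := merge_cycles (@agree' al x) ax y0 y2.
    rewrite -!/(cyc _) -/alx cy bxy /= => /esym/andP[/orP[/sub//|/sub y0x2] _].
    by apply: connect_trans y0x2 _; rewrite -/(cyc _) cyc_sym.
  move=> yx0; have yx2 : cyc top y0 x2 by exact: connect_trans yx0 cx2.
  by rewrite -(monomial_cons _ _ yx0) -(monomial_cons _ _ yx2) -(monomial_cons _ _ cy2).
(* merge then split: the same two cycles pass through x and through y *)
have nx2 : cyc top x0 x2 = false by rewrite cycyx.
have cx : cyc alx x0 x2 by rewrite cycx.
have := merge_cycles (@agree' alx y) bxy x0 x2.
rewrite -!/(cyc _) -/top cx nx2 /= => /esym/andP[].
have contra a : cyc top x0 a -> cyc top x2 a -> cyc top x0 x2.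
  by move=> x0a x2a; apply: connect_trans x0a _; rewrite -/(cyc _) cyc_sym.
move=> /orP[]x0y /orP[]x2y; try by rewrite (contra _ x0y x2y) in nx2.
  by rewrite (monomial_cons _ _ x0y) (monomial_cons _ _ x2y).
by rewrite (monomial_cons _ _ x0y) (monomial_cons _ _ x2y) addrC.
Qed.

Lemma dxi_coefE al x e e' : ~~ al x -> is_state (al, e) ->
  is_state (cube_head (al, x), e') ->
  dxi_coef K (al, x) e e' =
  \sum_(T <- edge_image al x (state_monomial al e))
     (monomial (cube_head (al, x)) T e')%:R.
Proof.
move=> alx eP e'P; rewrite -(edge_map_monomial K alx _ e'P) (bigD1 e) //=.
rewrite state_monomialE // eqxx mul1r big1 ?addr0 // => e2 /andP[_ /negPf ne].
by rewrite state_monomialE // ne mul0r.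
Qed.

(** The coefficient of the composite along the path that changes the smoothing
    first at x and then at y. *)
Definition square_coef al x y e e'' : K :=
  \sum_(e' | is_state (cube_head (al, x), e'))
     dxi_coef K (al, x) e e' * dxi_coef K (cube_head (al, x), y) e' e''.

Lemma square_coefE al x y e e'' : ~~ al x -> ~~ cube_head (al, x) y ->
  is_state (al, e) -> is_state (cube_head (cube_head (al, x), y), e'') ->
  square_coef al x y e e'' =
  \sum_(T <- edge_image al x (state_monomial al e))
     \sum_(T' <- edge_image (cube_head (al, x)) y T)
        (monomial (cube_head (cube_head (al, x), y)) T' e'')%:R.
Proof.
move=> alx aly eP e''P.
under [RHS]eq_bigr do rewrite -edge_map_monomial //.
rewrite exchange_big /=; apply: eq_bigr => e' e'P.
by rewrite dxi_coefE // mulr_suml.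
Qed.

Lemma square_coefC al x y e e'' : ~~ al x -> ~~ al y -> x != y ->
  is_state (al, e) -> is_state (cube_head (cube_head (al, x), y), e'') ->
  square_coef al x y e e'' = square_coef al y x e e''.
Proof.
move=> alx aly xy eP e''P.
have alxy : ~~ cube_head (al, x) y by rewrite ffunE /= negb_or eq_sym xy.
have alyx : ~~ cube_head (al, y) x by rewrite ffunE /= negb_or xy.
rewrite (square_coefE alx alxy eP e''P) edge_imageC //.
by rewrite cube_headC in e''P *; rewrite (square_coefE aly alyx eP e''P).
Qed.

Lemma height_cube_head al x : ~~ al x -> height (cube_head (al, x)) = (height al).+1.
Proof.
move=> /negPf alx; rewrite /height (bigD1 x) //= [in RHS](bigD1 x) //=.
rewrite ffunE /= eqxx alx.
by congr _.+1; apply: eq_bigr => y /negPf yx; rewrite ffunE /= yx.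
Qed.

Lemma cube_sign_head al x y : ~~ al x ->
  cube_sign K (cube_head (al, x), y) = (-1) ^+ (x < y)%N * cube_sign K (al, y).
Proof.
move=> /negPf alx; rewrite /cube_sign /= -exprD; congr (_ ^+ _).
case xy: (x < y)%N; last first.
  rewrite add0n; apply: eq_bigr => i iy; rewrite ffunE /=.
  by case: eqP iy => [->|//]; rewrite xy.
rewrite (bigD1 x) //= [in RHS](bigD1 x) //= ffunE /= eqxx alx.
by congr (_ + _)%N; apply: eq_bigr => i /andP[_ /negPf ix]; rewrite ffunE /= ix.
Qed.

(** Merging lowers the number of cycles by one and keeps the degree of the
    monomial, splitting raises both by one; v_- has degree -1 instead of 1 and
    the height rises by one, so that both maps have degree 0. *)
Lemma dxi_coef_deg al x e e' : ~~ al x -> is_state (al, e) ->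
  is_state (cube_head (al, x), e') -> dxi_coef K (al, x) e e' != 0 ->
  state_deg (cube_head (al, x), e') = state_deg (al, e).
Proof.
move=> alx eP e'P; rewrite dxi_coefE // => nz.
have [T Tim mT] : exists2 T, T \in edge_image al x (state_monomial al e)
    & monomial (cube_head (al, x)) T e'.
  apply/hasP; apply: contraNT nz => /hasPn noT.
  by rewrite big1_seq // => T /andP[_ /noT/negPf->].
have mS : monomial al (state_monomial al e) e by rewrite state_monomialE.
rewrite /state_deg /= (monomial_deg mT) (monomial_deg mS) height_cube_head //.
have /= [_ cnt] := bifurcation alx; move: Tim cnt; rewrite /edge_image.
case: (connect (on_cycle al) _ _) => /=; rewrite !inE.
  by case/orP=> /eqP-> /=; move: (n_comp _ _) (n_comp _ _) (size _) (height al); lia.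
by move=> /eqP->; move: (n_comp _ _) (n_comp _ _) (size _) (height al); lia.
Qed.

End Squares.
(** * The differential *)

(** The diagonal has to vanish by hypothesis, because 2 may be a zero divisor. *)
Lemma sum_antisymmetric (R : pzRingType) n (G : 'I_n -> 'I_n -> R) :
  (forall x, G x x = 0) -> (forall x y, x != y -> G x y = - G y x) ->
  \sum_x \sum_y G x y = 0.
Proof.
move=> Gxx Gxy; rewrite pair_bigA /=.
rewrite (bigID (fun p : 'I_n * 'I_n => p.1 < p.2)%N) /=.
pose swap (p : 'I_n * 'I_n) := (p.2, p.1).
rewrite [X in _ + X](reindex_inj (h := swap)) /=; last by case=> ? ? [? ?] [-> ->].
rewrite [X in _ + X](bigID (fun p : 'I_n * 'I_n => p.1 < p.2)%N) /=.
rewrite [X in _ + (_ + X)]big1; last first.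
  move=> [x y] /=; rewrite -!leqNgt -eqn_leq => /eqP/val_inj->; exact: Gxx.
rewrite addr0.
rewrite [X in _ + X](eq_bigl (fun p : 'I_n * 'I_n => p.1 < p.2)%N) => [|[x y] /=];
  last first.
  by case: ltngtP.
rewrite -big_split big1 //= => -[x y] /= xy.
by rewrite Gxy ?addNr //; apply: contraTneq xy => ->; rewrite ltnn.
Qed.

Section Differential.
Variables (K : fieldType) (L : link_projection).
Let n := ncr L.
Let E := edge L.
Let pair : finType := (vertex L * {ffun E -> bool})%type.
Implicit Types (al : vertex L) (x y : 'I_n).

(** The matrix of the differential on the states of all heights together, where
    the sums over intermediate states are not constrained by a height. *)
Definition diff_coef (s t : pair) : K :=
  \sum_(x | ~~ s.1 x && (t.1 == cube_head (s.1, x)))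
     cube_sign K (s.1, x) * dxi_coef K (s.1, x) s.2 t.2.

Definition dxi_fun (xi : cube_edge L) (r r' : int) (f : chain K L r) : chain K L r' :=
  [ffun t : state L r' =>
    \sum_(s : state L r |
           ((val s).1 == cube_tail xi) && ((val t).1 == cube_head xi))
      (f s : K) * dxi_coef K xi (val s).2 (val t).2].

Lemma dxi_fun_is_linear xi r r' : linear (@dxi_fun xi r r').
Proof.
move=> a f g; apply/ffunP => t; rewrite !ffunE scaler_sumr -big_split /=.
by apply: eq_bigr => s _; rewrite !ffunE mulrDl [in RHS]/GRing.scale /= mulrA.
Qed.

HB.instance Definition _ xi r r' :=
  GRing.isLinear.Build K (chain K L r) (chain K L r') _ (@dxi_fun xi r r')
    (@dxi_fun_is_linear xi r r').

Lemma chain_diffE r r' (f : chain K L r) (t : state L r') :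
  chain_diff K L r r' f t = \sum_s (f s : K) * diff_coef (val s) (val t) :> K.
Proof.
rewrite sum_lfunE sum_ffunE.
transitivity (\sum_(xi | is_cube_edge xi && ((height (cube_tail xi))%:Z == r))
   \sum_(s : state L r | ((val s).1 == cube_tail xi) && ((val t).1 == cube_head xi))
      (f s : K) * (cube_sign K xi * dxi_coef K xi (val s).2 (val t).2)).
  apply: eq_bigr => xi _; rewrite scale_lfunE (lfunE (@dxi_fun xi r r')) !ffunE.
  rewrite scaler_sumr; apply: eq_bigr => s _.
  by rewrite [LHS]mulrCA.
rewrite (exchange_big_dep predT) //=; apply: eq_bigr => s _.
rewrite -mulr_sumr; congr (_ * _).
rewrite /diff_coef (reindex_onto (fun x => ((val s).1, x)) snd) /=; last first.
  by case=> al x /= /andP[_ /andP[/eqP-> _]].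
apply: eq_bigl => x; rewrite /is_cube_edge /cube_tail /= !eqxx /= andbT.
by have /andP[_ ->] := valP s; rewrite andbT.
Qed.

Lemma sum_states (r : int) (F : pair -> K) :
  \sum_(u : state L r) F (val u) =
  \sum_al \sum_(e | is_state (al, e) && ((height al)%:Z == r)) F (al, e).
Proof.
rewrite -(big_sub [pred s : pair | is_state s && ((height s.1)%:Z == r)] F).
by rewrite pair_big_dep /=; apply: eq_big => -[al e].
Qed.

(** Distinct crossings x and y contribute to the square of the differential
    through two paths, with the same coefficient and opposite signs. *)
Lemma diff_coef_square (r : int) (s t : pair) : is_state s -> is_state t ->
  r = (height s.1)%:Z + 1 ->
  \sum_(u : state L r) diff_coef s (val u) * diff_coef (val u) t = 0.
Proof.
case: s t => [al e] [ga e''] /= eP e''P ->.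
rewrite (sum_states _ (fun u => diff_coef (al, e) u * diff_coef u (ga, e''))).
pose G x y : K :=
  if [&& ~~ al x, ~~ al y, x != y & ga == cube_head (cube_head (al, x), y)]
  then cube_sign K (al, x) * cube_sign K (cube_head (al, x), y) *
         square_coef K al x y e e''
  else 0.
rewrite -[RHS](@sum_antisymmetric K _ G); first last.
- move=> x y xy; have yx : y != x by rewrite eq_sym.
  rewrite /G xy yx (cube_headC al y x) /=.
  case alx: (al x); rewrite /= ?oppr0 //; first by rewrite andbF oppr0.
  case aly: (al y); rewrite /= ?oppr0 //.
  case: eqP => [gaE|]; rewrite ?oppr0 //.
  rewrite square_coefC ?alx ?aly //; last by rewrite -gaE.
  rewrite !cube_sign_head ?alx ?aly // -mulNr; congr (_ * _).
  rewrite mulrCA [in RHS]mulrCA [cube_sign K (al, y) * _]mulrC -mulNr; congr (_ * _).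
  case: ltngtP xy => [||/val_inj->]; rewrite ?eqxx //= ?expr1 ?expr0 ?opprK //.
- by move=> x; rewrite /G eqxx !andbF.
transitivity (\sum_(x | ~~ al x) \sum_(e' | is_state (cube_head (al, x), e'))
    cube_sign K (al, x) * dxi_coef K (al, x) e e' *
      diff_coef (cube_head (al, x), e') (ga, e'')).
  have exch be : \sum_(e' | is_state (be, e') && ((height be)%:Z == (height al)%:Z + 1))
      diff_coef (al, e) (be, e') * diff_coef (be, e') (ga, e'') =
    \sum_(x | ~~ al x && (be == cube_head (al, x)))
      \sum_(e' | is_state (be, e') && ((height be)%:Z == (height al)%:Z + 1))
        cube_sign K (al, x) * dxi_coef K (al, x) e e' * diff_coef (be, e') (ga, e'').
    rewrite exchange_big /=; apply: eq_bigr => e' _.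
    by rewrite [diff_coef (al, e) _]/diff_coef mulr_suml.
  under eq_bigr do rewrite exch.
  rewrite (exchange_big_dep (fun x => ~~ al x)) /= => [|be x _ /andP[]//].
  apply: eq_bigr => x alx; rewrite (big_pred1 (cube_head (al, x))) => [|be].
    apply: eq_bigl => e'; rewrite height_cube_head //.
    by rewrite -addn1 PoszD eqxx andbT.
  by rewrite /= alx.
rewrite [LHS]big_mkcond; apply: eq_bigr => x _; rewrite /G.
case alx: (al x) => /=; first by rewrite big1.
under eq_bigr do rewrite /diff_coef /= mulr_sumr.
rewrite (exchange_big_dep (fun y => ~~ cube_head (al, x) y &&
  (ga == cube_head (cube_head (al, x), y)))) //=.
rewrite [LHS]big_mkcond; apply: eq_bigr => y _.
have -> : ~~ cube_head (al, x) y = ~~ al y && (x != y).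
  by rewrite ffunE /= negb_or eq_sym andbC.
rewrite -andbA; case: ifP => // yP; rewrite /square_coef mulr_sumr.
by apply: eq_big => [e'|e' _]; rewrite ?yP ?andbT // mulrACA.
Qed.

Lemma chain_diff_square (r r' r'' : int) (f : chain K L r) : r' = r + 1 ->
  chain_diff K L r' r'' (chain_diff K L r r' f) = 0.
Proof.
move=> r'E; apply/ffunP => t; rewrite chain_diffE [RHS]ffunE.
under eq_bigr do rewrite chain_diffE mulr_suml.
rewrite exchange_big big1 //= => s _.
under eq_bigr do rewrite -mulrA.
rewrite -mulr_sumr diff_coef_square ?mulr0 //.
- by case/andP: (valP s).
- by case/andP: (valP t).
- by case/andP: (valP s) => _ /eqP->.
Qed.

Lemma diff_coef_deg (s t : pair) : is_state s -> is_state t -> diff_coef s t != 0 ->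
  state_deg t = state_deg s.
Proof.
case: s t => [al e] [be e'] eP e'P; apply: contraNeq => ne.
rewrite /diff_coef big1 // => x /andP[/= alx /eqP beE].
apply/eqP; rewrite mulf_eq0; apply/orP; right; apply: contraNT ne => nz.
by rewrite beE in e'P *; apply/eqP/(dxi_coef_deg alx eP e'P nz).
Qed.

(** ** The graded pieces *)

Let deg r (s : state L r) : int := state_deg (val s).

Lemma chain_expand r (f : chain K L r) :
  f = \sum_(s : state L r) (f s : K) *: basis_elt K s.
Proof.
apply/ffunP => t.
have basisE s : ((f s : K) *: basis_elt K s) t = (f s : K) * (t == s)%:R :> K.
  by rewrite [LHS]ffunE [basis_elt K s t]ffunE.
rewrite sum_ffunE (bigD1 t) //= basisE eqxx mulr1 big1 ?addr0 // => s ne.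
by rewrite basisE eq_sym (negPf ne) mulr0.
Qed.

Lemma mem_chain_piece r m (f : chain K L r) :
  reflect (forall s : state L r, f s != 0 -> deg s = m) (f \in chain_piece K L r m).
Proof.
apply: (iffP idP) => [|fP].
  set B := in_tuple
    [seq basis_elt K s | s <- enum (state L r) & state_deg (val s) == m].
  move=> fP s; rewrite (coord_span (X := B) fP); apply: contraNeq => ne.
  rewrite sum_ffunE big1 // => i _; rewrite !ffunE.
  have := mem_nth 0 (ltn_ord i).
  case/mapP=> s'; rewrite mem_filter => /andP[/eqP ds' _] e.
  rewrite (_ : _`_i = basis_elt K s') // ffunE; case: eqP => [ss'|_].
    by rewrite -ds' -ss' eqxx in ne.
  exact: mulr0.
rewrite [f]chain_expand; apply: rpred_sum => s _.
have [->|nz] := eqVneq (f s) 0; first by rewrite scale0r rpred0.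
apply/rpredZ/memv_span/map_f; rewrite mem_filter mem_enum andbT.
exact/eqP/fP.
Qed.

Lemma free_basis_elts r (l : seq (state L r)) :
  uniq l -> free [seq basis_elt K s | s <- l].
Proof.
move=> ul; case: l ul => [|s0 l'] ul; first exact: nil_free.
set l := s0 :: l' in ul *; set B := map _ _; suff: free (in_tuple B) by [].
have lt (j : 'I_(size B)) : (j < size l)%N.
  exact: leq_trans (ltn_ord j) (eq_leq (size_map _ _)).
have BE (j : 'I_(size B)) : (in_tuple B)`_j = basis_elt K (nth s0 l j).
  by rewrite (nth_map s0).
apply/freeP => k k0 i.
have := congr1 (fun f : chain K L r => f (nth s0 l i) : K) k0.
rewrite sum_ffunE (bigD1 i) //= big1 => [|j ne]; last first.
  rewrite BE !ffunE nth_uniq // eq_sym (negPf (ne : val _ != val _)).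
  exact: mulr0.
by rewrite BE !ffunE eqxx addr0 [k i *: _]mulr1.
Qed.

Lemma dim_chain_piece r m :
  \dim (chain_piece K L r m) = #|[pred s : state L r | deg s == m]|.
Proof.
have := free_basis_elts (filter_uniq (fun s => deg s == m) (enum_uniq (state L r))).
rewrite /free => /eqP->; rewrite size_map cardE /enum_mem -filter_predI.
by congr size; apply: eq_filter => s; rewrite !inE andbT.
Qed.

Definition grade_proj r (m : int) (f : chain K L r) : chain K L r :=
  [ffun s => if deg s == m then f s else 0].

Lemma grade_proj_piece r m (f : chain K L r) : grade_proj m f \in chain_piece K L r m.
Proof.
apply/mem_chain_piece => s; rewrite ffunE.
by have [//|_] := eqVneq (deg s) m; rewrite eqxx.
Qed.

Lemma chain_diff_piece r r' m (f : chain K L r) : f \in chain_piece K L r m ->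
  chain_diff K L r r' f \in chain_piece K L r' m.
Proof.
move=> /mem_chain_piece fP; apply/mem_chain_piece => t.
apply: contraNeq => ne; rewrite chain_diffE big1 // => s _.
apply/eqP; rewrite mulf_eq0; apply: contraNT ne; rewrite negb_or => /andP[fs ds].
have /andP[sP _] := valP s; have /andP[tP _] := valP t.
by rewrite /deg (diff_coef_deg sP tP ds); apply/eqP/fP.
Qed.

(** As the differential has degree 0, it commutes with the projections onto the
    pieces; so a boundary in degree m is the boundary of an element of degree
    m. *)
Lemma chain_diff_proj r r' m (f : chain K L r) :
  chain_diff K L r r' f \in chain_piece K L r' m ->
  chain_diff K L r r' f = chain_diff K L r r' (grade_proj m f).
Proof.
move=> /mem_chain_piece dfP; apply/ffunP => t.
have /andP[tP _] := valP t.
have [dt|ne] := eqVneq (deg t) m; last first.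
  transitivity (0 : K); last symmetry.
    by apply/eqP; apply: contraNT ne => /dfP->.
  have /mem_chain_piece dpP := chain_diff_piece r' (grade_proj_piece m f).
  by apply/eqP; apply: contraNT ne => /dpP->.
rewrite !chain_diffE; apply: eq_bigr => s _; rewrite ffunE.
have [//|ne] := eqVneq (deg s) m.
have /andP[sP _] := valP s.
have -> : diff_coef (val s) (val t) = 0; last by rewrite !mulr0.
apply/eqP; apply: contraNT ne => /(diff_coef_deg sP tP) e.
by rewrite /deg -e -dt.
Qed.

End Differential.
(** * Euler characteristics of graded complexes *)

Lemma sum_int_finite (R : nmodType) (s : seq int) (F : int -> R) : uniq s ->
  (forall i, i \notin s -> F i = 0) ->
  \sum_(i \in [set: int]%classic) F i = \sum_(i <- s) F i.
Proof.
move=> us F0; rewrite [RHS]fsbig_seq //; apply/esym/fsbig_widen => //.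
by move=> i [_ /negP/F0].
Qed.

Section GradedEuler.
Variables (K : fieldType) (C : gcomplex K).
Let d r := gdiff C (r - 1) r.
Let P r m := gpiece C r m.

Variable dd : forall r v, gdiff C r (r + 1) (d r v) = 0.
Variable d_piece : forall r m v, v \in P (r - 1) m -> d r v \in P r m.
(* d_homogeneous holds whenever d commutes with the projections onto the pieces *)
Variable d_homogeneous : forall r m v, d r v \in P r m ->
  exists2 w, w \in P (r - 1) m & d r w = d r v.

(** By homogeneity of d, these are all the boundaries of degree m. *)
Let B r m := (d r @: P (r - 1) m)%VS.

Let B_next r m : \dim (B (r + 1) m) = \dim (gdiff C r (r + 1) @: P r m).
Proof. by rewrite /B /d /P addrK. Qed.

Let dim_homology r m :
  (\dim (homology C r m) + \dim (B r m) + \dim (B (r + 1) m))%N = \dim (P r m).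
Proof.
rewrite B_next -(limg_ker_dim (gdiff C r (r + 1)) (P r m)); congr addn.
rewrite capvC -(dimv_cap_compl (lker _ :&: P r m) (limg (d r))) addnC.
congr addn; congr (\dim _); apply/vspaceP => v; rewrite !memv_cap.
apply/memv_imgP/idP => [[w wP ->]|].
  by rewrite memv_ker dd eqxx d_piece //= memv_img ?memvf.
case/andP=> /andP[_ vP] /memv_imgP[w _ vE].
by move: vP; rewrite vE => /d_homogeneous[w' w'P <-]; exists w'.
Qed.

Variables (r0 : int) (k : nat) (ms : seq int).
Let rs := [seq r0 + i%:Z | i <- iota 0 k].
Variable ms_uniq : uniq ms.
Variable P_support : forall r m, P r m != 0%VS -> (r \in rs) && (m \in ms).

Let P_support0 r m : ~~ ((r \in rs) && (m \in ms)) -> P r m = 0%VS.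
Proof. by apply: contraNeq => /P_support. Qed.

Let homology0 r m : ~~ ((r \in rs) && (m \in ms)) -> \dim (homology C r m) = 0%N.
Proof.
move=> /P_support0 P0; apply/eqP; rewrite -leqn0.
by have := dim_homology r m; rewrite P0 dimv0; lia.
Qed.

(* The complex is 0 outside the heights r0, ..., r0 + k - 1, so that the
   telescoping sum has vanishing boundary terms. *)
Let B_first m : \dim (B r0 m) = 0%N.
Proof.
rewrite /B P_support0 ?limg0 ?dimv0 //; apply/negP => /andP[/mapP[i _]] /eqP.
by lia.
Qed.

Let B_last m : \dim (B (r0 + k%:Z) m) = 0%N.
Proof.
apply/eqP; rewrite -leqn0.
have := dim_homology (r0 + k%:Z) m; rewrite P_support0 ?dimv0; first by lia.
by apply/negP => /andP[/mapP[i]]; rewrite mem_iota => ik /eqP; lia.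
Qed.

Let telescope (b : nat -> laurent) j :
  \sum_(i < j) (-1) ^+ i * (b i + b i.+1) = b 0%N - (-1) ^+ j * b j.
Proof.
elim: j => [|j IH]; first by rewrite big_ord0 expr0 mul1r subrr.
by rewrite big_ord_recr /= IH exprS; ring.
Qed.

(** The rank of each differential is subtracted from the dimensions of two
    consecutive homology groups, hence cancels in the alternating sum. *)
Lemma euler_q_pieces :
  euler_q C = \sum_(r <- rs) \sum_(m <- ms) (-1) ^ r * q ^ m * (\dim (P r m))%:R.
Proof.
have rs_uniq : uniq rs by rewrite map_inj_uniq ?iota_uniq // => i j /addrI[].
have -> : euler_q C =
    \sum_(r <- rs) \sum_(m <- ms) (-1) ^ r * q ^ m * (\dim (homology C r m))%:R.
  have qdimE r : qdim_homology C r = \sum_(m <- ms) q ^ m * (\dim (homology C r m))%:R.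
    apply: sum_int_finite => // m mms.
    by rewrite homology0 ?mulr0 // (negPf mms) andbF.
  rewrite /euler_q (sum_int_finite rs_uniq) => [|r rrs].
    apply: eq_bigr => r _; rewrite qdimE mulr_sumr.
    by apply: eq_bigr => m _; rewrite mulrA.
  by rewrite qdimE big1 ?mulr0 // => m _; rewrite homology0 ?mulr0 // (negPf rrs).
rewrite exchange_big [RHS]exchange_big /=; apply: eq_bigr => m _.
pose b i : laurent := (\dim (B (r0 + i%:Z) m))%:R.
suff alt : \sum_(r <- rs) (-1) ^ r *
    ((\dim (B r m))%:R + (\dim (B (r + 1) m))%:R : laurent) = 0.
  transitivity (\sum_(r <- rs) (-1) ^ r * q ^ m *
      ((\dim (homology C r m))%:R + (\dim (B r m))%:R + (\dim (B (r + 1) m))%:R)).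
    have := congr1 (fun z => \sum_(r <- rs) (-1) ^ r * q ^ m *
      (\dim (homology C r m))%:R + q ^ m * z) alt.
    rewrite mulr0 addr0 => <-; rewrite mulr_sumr -big_split /=.
    by apply: eq_bigr => r _; ring.
  by apply: eq_bigr => r _; rewrite -!natrD dim_homology.
have -> : rs = [seq r0 + i%:Z | i <- index_iota 0 k] by rewrite /index_iota subn0.
rewrite big_map big_mkord.
have m1n0 : (-1 : laurent) != 0 by rewrite oppr_eq0 oner_eq0.
transitivity ((-1) ^ r0 * \sum_(i < k) (-1) ^+ i * (b i + b i.+1)).
  rewrite mulr_sumr; apply: eq_bigr => i _; rewrite expfzDr // -mulrA.
  by rewrite /b -addn1 PoszD addrA.
by rewrite telescope /b addr0 B_first B_last mulr0n mulr0 subrr mulr0.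
Qed.

End GradedEuler.
(** * State sums *)

Lemma q_neq0 : q != 0.
Proof. by rewrite /q tofrac_eq0 polyX_eq0. Qed.

(** The skein relation is applied at all crossings of l.  Fixing the smoothings
    outside l to be those of be makes the sum of the induction step split into
    the two sums for the tail of l, with be updated at its head. *)
Lemma bracket_expand (I E : finType) (f : I -> crossing E) (l : seq I)
    (be : {ffun I -> bool}) (s : seq (E * E)) : uniq l ->
  bracket [seq f i | i <- l] s =
  \sum_(al : {ffun I -> bool} | [forall i, (i \in l) || (al i == be i)])
     (- q) ^+ (\sum_(i <- l) al i) *
     (q + q^-1) ^+ ncycles (flatten [seq smoothing (f i) (al i) | i <- l] ++ s).
Proof.
elim: l be s => [|i l IH] be s => [_ /=|/= /andP[il ul]].
  rewrite (big_pred1 be) => [|al]; first by rewrite big_nil expr0 mul1r.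
  by apply/forallP/eqP => [eq_al|->//]; apply/ffunP => i; apply/eqP; have := eq_al i.
pose upd b : {ffun I -> bool} := [ffun j => if j == i then b else be j].
have updE b (al : {ffun I -> bool}) : [forall j, (j \in l) || (al j == upd b j)] =
    [forall j, (j \in i :: l) || (al j == be j)] && (al i == b).
  apply/forallP/andP => [alP|[/forallP alP ali] j].
    split; last by have := alP i; rewrite (negPf il) ffunE eqxx.
    by apply/forallP => j; have := alP j; rewrite inE ffunE; case: (j == i).
  by have := alP j; rewrite inE ffunE; case: eqP => [->|//]; rewrite ali orbT.
have cyc_cat (al : {ffun I -> bool}) b : al i = b ->
    ncycles (flatten [seq smoothing (f j) (al j) | j <- l] ++
      (smoothing (f i) b ++ s)) =
    ncycles ((smoothing (f i) (al i) ++
      flatten [seq smoothing (f j) (al j) | j <- l]) ++ s).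
  move=> ->; apply: eq_n_comp; apply: eq_connect => u v.
  by rewrite /linked !mem_cat; congr (_ || _); rewrite orbCA orbA.
rewrite (IH (upd false)) // (IH (upd true)) // -!/(smoothing _ _).
rewrite [RHS](bigID (fun al : {ffun I -> bool} => al i == false)) /=; congr (_ + _).
  apply: eq_big => [al|al]; rewrite ?updE // => /andP[_ /eqP ali].
  by rewrite -(cyc_cat al false) // big_cons ali.
rewrite mulr_sumr -sumrN; apply: eq_big => [al|al].
  by rewrite updE; case: (al i).
rewrite updE => /andP[_ /eqP ali].
by rewrite -(cyc_cat al true) // big_cons ali add1n exprS !mulNr mulrA.
Qed.

Lemma kauffman_state_sum (L : link_projection) :
  kauffman L = \sum_(al : vertex L)
    (- q) ^+ height al * (q + q^-1) ^+ n_comp (on_cycle al) predT.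
Proof.
rewrite /kauffman (bracket_expand _ [ffun => false]) ?enum_uniq //.
apply: eq_big => [al|al _]; first by apply/forallP => i; rewrite mem_enum.
by rewrite cats0 big_enum.
Qed.

(** A state is an independent choice of a sign on each cycle. *)
Lemma state_sum (L : link_projection) (al : vertex L) :
  \sum_(e | is_state (al, e))
     q ^ (\sum_(a | fingraph.roots (on_cycle al) a) (if e a then 1 else -1)) =
  (q + q^-1) ^+ n_comp (on_cycle al) predT.
Proof.
set R := on_cycle al.
have symR : connect_sym R by exact: on_cycle_sym.
transitivity (\prod_(a | fingraph.roots R a) \sum_(b : bool) q ^ (if b then 1 else -1)).
  rewrite (big_distr_big false).
  (* functions constant on cycles against functions supported on the roots *)
  pose h (e : {ffun edge L -> bool}) : {ffun edge L -> bool} :=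
    [ffun a => fingraph.roots R a && e a].
  pose h' (f : {ffun edge L -> bool}) : {ffun edge L -> bool} :=
    [ffun a => f (fingraph.root R a)].
  rewrite [RHS](reindex_onto h h') /=; last first.
    move=> f /pfamilyP[/supportP fP _]; apply/ffunP => a; rewrite !ffunE.
    by have [/eqP->//|/fP->] := boolP (fingraph.roots R a).
  apply: eq_big => [e|e _].
    have -> : h e \in pffun_on false (fingraph.roots R) predT.
      apply/pfamilyP; split=> //; apply/supportP => a.
      by rewrite ffunE => /negPf ra; rewrite [fingraph.roots R a]ra.
    apply/is_stateP/eqP => [eP|<- a b ab].
      apply/ffunP => a; rewrite !ffunE roots_root //=.
      by apply/esym/eP/connect_root.
    by rewrite !ffunE (fingraph.rootP symR ab).
  rewrite (big_morph (fun m : int => q ^ m) (fun m n => expfzDr m n q_neq0) (expr0z q)).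
  by apply: eq_bigr => a ra; rewrite ffunE ra.
rewrite prodr_const big_bool expr1z exprN1.
by congr (_ ^+ _); apply: eq_card => a; rewrite !inE andbT.
Qed.

Section KhovanovEuler.
Variables (K : fieldType) (L : link_projection).
Let n := ncr L.
Let shift : int := (npos L)%:Z - 2 * (nneg L)%:Z.
Let pair : finType := (vertex L * {ffun edge L -> bool})%type.

Let heights : seq int := [seq - (nneg L)%:Z + i%:Z | i <- iota 0 n.+1].
Let degrees : seq int := undup [seq state_deg p + shift | p : pair].

Lemma height_le (al : vertex L) : (height al <= n)%N.
Proof.
rewrite /height -[X in (_ <= X)%N]card_ord -sum1_card.
by apply: leq_sum => i _; case: (al i).
Qed.

Let mem_heights (al : vertex L) : (height al)%:Z - (nneg L)%:Z \in heights.
Proof.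
by apply/mapP; exists (height al); rewrite ?mem_iota ?ltnS ?height_le // addrC.
Qed.

Let heights_uniq : uniq heights.
Proof. by rewrite map_inj_uniq ?iota_uniq // => i j /addrI[]. Qed.

Let mem_degrees (p : pair) : state_deg p + shift \in degrees.
Proof. by rewrite mem_undup; apply/mapP; exists p; rewrite ?mem_enum. Qed.

Let dim_piece (r m : int) :
  (\dim (gpiece (khovanov K L) r m))%:R =
  \sum_(p : pair | is_state p)
    ((r == (height p.1)%:Z - (nneg L)%:Z) && (m == state_deg p + shift))%:R :> laurent.
Proof.
rewrite /= dim_chain_piece -sum1_card natr_sum big_mkcond /=.
set r' := r - _; set m' := m - _.
rewrite -(big_sub [pred p : pair | is_state p && ((height p.1)%:Z == r')]
  (fun p => if state_deg p == m' then 1 else 0)).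
rewrite big_mkcondr; apply: eq_bigr => p _.
have -> : (r == (height p.1)%:Z - (nneg L)%:Z) = ((height p.1)%:Z == r').
  by apply/eqP/eqP; rewrite /r'; lia.
have -> : (m == state_deg p + shift) = (state_deg p == m').
  by apply/eqP/eqP; rewrite /m' /shift; lia.
by case: ((height p.1)%:Z == r') (state_deg p == m') => [] [].
Qed.

(** The Euler characteristic of the homology is that of the complex, and the
    states are a basis of the complex. *)
Lemma euler_q_state_sum :
  euler_q (khovanov K L) =
  \sum_(p : pair | is_state p)
    (-1) ^ ((height p.1)%:Z - (nneg L)%:Z) * q ^ (state_deg p + shift).
Proof.
rewrite (@euler_q_pieces K (khovanov K L) _ _ _ (- (nneg L)%:Z) n.+1 degrees).
- rewrite -/heights; under eq_bigr do under eq_bigr do rewrite dim_piece mulr_sumr.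
  under eq_bigr do rewrite exchange_big.
  rewrite exchange_big; apply: eq_bigr => p _.
  rewrite (bigD1_seq _ (mem_heights p.1) heights_uniq).
  rewrite (bigD1_seq (state_deg p + shift)) ?mem_degrees ?undup_uniq //=.
  rewrite !eqxx mulr1 big1 ?addr0 => [|m /negPf->]; last by rewrite andbF mulr0.
  by rewrite big1 ?addr0 // => r /negPf->; rewrite big1 // => m _; rewrite mulr0.
- by move=> r v /=; apply: chain_diff_square; lia.
- by move=> r m v; exact: chain_diff_piece.
- move=> r m v dv; exists (grade_proj (m - shift) v); first exact: grade_proj_piece.
  by apply/esym/chain_diff_proj.
- exact: undup_uniq.
- move=> r m; rewrite -dimv_eq0 /= dim_chain_piece -lt0n => /card_gt0P[s].
  rewrite inE => /eqP ds; have /andP[_ /eqP hs] := valP s.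
  have -> : r = (height (val s).1)%:Z - (nneg L)%:Z by rewrite hs; lia.
  have -> : m = state_deg (val s) + shift by rewrite ds /shift; lia.
  by rewrite mem_heights mem_degrees.
Qed.

End KhovanovEuler.

Theorem theorem1 (K : fieldType) (L : link_projection) :
  euler_q (khovanov K L) = jones L.
Proof.
rewrite euler_q_state_sum /jones kauffman_state_sum mulr_sumr.
rewrite -(pair_big_dep predT (fun al e => is_state (al, e))
  (fun al e => (-1) ^ ((height al)%:Z - (nneg L)%:Z) *
     q ^ (state_deg (al, e) + ((npos L)%:Z - 2 * (nneg L)%:Z)))) /=.
apply: eq_bigr => al _; rewrite -state_sum mulr_sumr mulr_sumr.
apply: eq_bigr => e _.
have m1n0 : (-1 : laurent) != 0 by rewrite oppr_eq0 oner_eq0.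
rewrite /state_deg /= !(expfzDr _ _ q_neq0) (expfzDr _ _ m1n0) (exprNn q).
rewrite -exprz_inv invrN1 -!exprnP; ring.
Qed.
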